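(* Let $\theta > 0$. For each $n \ge 1$, let $L_n$ denote the length of the longest cycle of a random permutation $\sigma \in S_n$ distributed according to the Ewens measure $\mathbb{P}_n^{\theta}$ with parameter $\theta$, and let $\mathbb{E}_n^{\theta}$ denote expectation with respect to $\mathbb{P}_n^{\theta}$. Then the limit $$\lambda_\theta := \lim_{n \to \infty} \frac{\mathbb{E}_n^{\theta}[L_n]}{n}$$ exists and is given by $$\lambda_\theta = \int_0^\infty \exp\bigl[-t - \theta E_1(t)\bigr]\,dt.$$
   Context: $S_n$ is the symmetric group on $\{1,\dots,n\}$. For $\sigma \in S_n$, $C(\sigma)$ denotes the total number of cycles of $\sigma$ (fixed points count as cycles of length $1$). The Ewens measure with parameter $\theta>0$ on $S_n$ is the probability measure $$\mathbb{P}_n^{\theta}(\sigma) = \frac{\theta^{C(\sigma)}}{\theta(\theta+1)\cdots(\theta+n-1)}, \qquad \sigma \in S_n.$$ $E_1$ is the exponential integral $E_1(x) = \int_x^\infty \frac{e^{-t}}{t}\,dt$ for $x > 0$. *)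

(* Defs.v *)
From HB Require Import structures.
From mathcomp Require Import all_boot all_order all_algebra all_fingroup.
From mathcomp Require Import all_classical all_reals all_analysis.

Set Implicit Arguments.
Unset Strict Implicit.
Unset Printing Implicit Defensive.

Import Order.TTheory GRing.Theory Num.Theory.
Import numFieldNormedType.Exports.

Local Open Scope classical_set_scope.
Local Open Scope ring_scope.

(* [porbits s] partitions the whole of 'I_n, so fixed points are cycles of
   length 1. *)
Definition num_cycles (n : nat) (s : 'S_n) : nat := #|porbits s|.

Definition longest_cycle (n : nat) (s : 'S_n) : nat :=
  \max_(c in porbits s) #|c|.

(* The Ewens measure is given by its point masses. *)
Definition ewens (R : realType) (theta : R) (n : nat) (s : 'S_n) : R :=
  theta ^+ num_cycles s / \prod_(i < n) (theta + i%:R).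

Definition ewens_expectation (R : realType) (theta : R) (n : nat)
    (X : 'S_n -> R) : R :=
  \sum_(s : 'S_n) X s * ewens theta s.

(* Meaningful for 0 < x only: otherwise the integral diverges and [Rintegral]
   returns 0. *)
Definition expint1 (R : realType) (x : R) : R :=
  \int[lebesgue_measure]_(t in `]x, +oo[) (expR (- t) / t).

(* Main.v *)
Require Import Defs.
From mathcomp Require Import all_boot all_order all_algebra all_fingroup.
From mathcomp Require Import zify ring lra.
From mathcomp Require Import all_classical all_reals all_analysis.
From mathcomp Require Import measurable_realfun.

Import Order.TTheory GRing.Theory Num.Theory.
Import numFieldNormedType.Exports.

Local Open Scope ring_scope.

(** Write x = exp(-s). The law of the longest cycle becomes tractable when the
size n of the permutation is itself random, with weight proportional to
w(n) x^n, where w(n) = theta (theta + 1) ... (theta + n - 1) / n!: the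
generating function of the permutations whose cycles all have length at most m
is then exp (theta (x + x^2 / 2 + ... + x^m / m)). The proof obtains the
limit along this randomisation and transfers it to fixed n by monotonicity.

Combinatorics. Deleting one point from a permutation of n + 1 points and
closing the gap shows that sums over S_(n+1) of a function of the cycle
lengths, weighted by theta^C, reduce to sums over S_n ([cycle_sumS]).
Everything else about permutations follows from this recursion through
[cycle_coef_first] and [cycle_coef_marked]: removing the cycle of a given point,
of length k + 1, leaves an arbitrary weighted permutation of the n - k - 1 other
points.

The limit exists. Deleting a uniformly chosen point turns the Ewens measure on
S_(n+1) into the one on S_n, and shortens the longest cycle by at most one, with
probability at most L / (n + 1). Hence E[L_n] / n is nonincreasing
([mean_ratioS]) and converges to some lambda >= 0.

Its value. Since L_n is between the sum of the lengths of the cycles that are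
strictly longer than all others and the sum of the lengths of the cycles that
are at least as long as all others, marking a point gives
[longest_coef_ge] and [longest_coef_le], whose generating functions are
theta * sum_k x^(k+1) A_k(x) and theta * sum_k x^(k+1) A_(k+1)(x), where A_m is
the generating function of the permutations with cycles of length at most m.
If W is the generating function of all the w(n), then W / A_m is the exponential
of theta times the tail x^(m+1) / (m+1) + x^(m+2) / (m+2) + ..., which lies between
E_1((m+1)s) and E_1(ms) ([genfun_total_bounds]). So both sums are Riemann sums
of step s for (theta W / s) * int_0^oo exp(-t - theta E_1(t)) dt
([genfun_longest_le], [genfun_longest_ge]). On the other hand, as E[L_n] / n
tends to lambda, the generating function of [longest_coef] is asymptotic to
lambda times sum_n n w(n) x^n = theta W x / (1 - x), and s x / (1 - x) tends to 1 when s
tends to 0. Comparing the two identifies lambda ([mean_ratio_cvg]). *)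

(** * Inserting a point into a cycle of a permutation *)

Section Insertion.
Set Implicit Arguments.
Unset Strict Implicit.
Implicit Types n : nat.

Definition cycle_lengths n (s : 'S_n) : seq nat :=
  [seq #|c| | c : {set 'I_n} <- enum (porbits s)].

(** The permutation in which the new point [ord0] is placed just before [j] in the
cycle of [j], or forms a cycle of its own when [j] is [ord0]. *)
Definition insert n (t : 'S_n) (j : 'I_n.+1) : 'S_n.+1 :=
  (lift_perm ord0 ord0 t * tperm ord0 j)%g.

Lemma insert_ord0 n (t : 'S_n) j : insert t j ord0 = j.
Proof. by rewrite permM lift_perm_id tpermL. Qed.

Lemma insert_lift n (t : 'S_n) j x :
  insert t j (lift ord0 x) = tperm ord0 j (lift ord0 (t x)).
Proof. by rewrite permM lift_perm_lift. Qed.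

Lemma insert_bij n :
  bijective (fun p : 'S_n * 'I_n.+1 => insert p.1 p.2).
Proof.
apply: inj_card_bij; last first.
  by rewrite card_prod !card_Sn card_ord factS mulnC.
move=> [t j] [t' j'] /= e.
have ej : j = j' by rewrite -(insert_ord0 t j) e insert_ord0.
rewrite -{}ej in e *; congr (_, _); apply/permP => x.
have := congr1 (fun u : 'S_n.+1 => u (lift ord0 x)) e.
by rewrite !insert_lift => /perm_inj/lift_inj.
Qed.

(** Collapses the inserted point onto the point [j] in front of which it was
placed, so that cycles after insertion are preimages of cycles before it. *)
Definition retract n (j : 'I_n) (x : 'I_n.+1) : 'I_n := odflt j (unlift ord0 x).

Lemma retract0 n (j : 'I_n) : retract j ord0 = j.
Proof. by rewrite /retract unlift_none. Qed.

Lemma retract_lift n (j x : 'I_n) : retract j (lift ord0 x) = x.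
Proof. by rewrite /retract liftK. Qed.

Lemma porbit_step (T : finType) (s : {perm T}) x : s x \in porbit s x.
Proof. by rewrite (mem_porbit s 1). Qed.

Lemma porbit_trans (T : finType) (s : {perm T}) x y z :
  x \in porbit s y -> y \in porbit s z -> x \in porbit s z.
Proof. by rewrite -!eq_porbit_mem => /eqP -> . Qed.

(** The retraction sends one step of the new permutation to zero or one step of
[t]; conversely one step of [t] lifts to one or two steps of the new one. *)
Lemma porbit_insert_lift n (t : 'S_n) j x :
  porbit (insert t (lift ord0 j)) x = retract j @^-1: porbit t (retract j x).
Proof.
set s := insert t _.
have rs z : retract j (s z) \in porbit t (retract j z).
  case: (unliftP ord0 z) => [z' ->|->].
    rewrite insert_lift retract_lift; case: tpermP => [//|/lift_inj e|_ _].
      by rewrite retract0 -e porbit_step.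
    by rewrite retract_lift porbit_step.
  by rewrite insert_ord0 retract_lift retract0 porbit_id.
have ss z' : lift ord0 (t z') \in porbit s (lift ord0 z').
  have [e|ne] := eqVneq (t z') j.
    have e0 : s (lift ord0 z') = ord0 by rewrite insert_lift e tpermR.
    have := porbit_trans (porbit_step s _) (porbit_step s (lift ord0 z')).
    by rewrite e0 insert_ord0 e.
  have -> : lift ord0 (t z') = s (lift ord0 z').
    rewrite insert_lift tpermD ?neq_lift // (inj_eq lift_inj) eq_sym //.
  exact: porbit_step.
have l z' i : lift ord0 ((t ^+ i)%g z') \in porbit s (lift ord0 z').
  elim: i => [|i IH]; first by rewrite expg0 perm1 porbit_id.
  by rewrite expgSr permM; apply: porbit_trans IH.
have lr z : z \in porbit s (lift ord0 (retract j z)).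
  case: (unliftP ord0 z) => [z' ->|->]; first by rewrite retract_lift porbit_id.
  by rewrite retract0 porbit_sym -(insert_ord0 t (lift ord0 j)) porbit_step.
apply/setP => y; rewrite inE; apply/idP/idP.
  case/porbitP => i ->; elim: i => [|i IH]; first by rewrite expg0 perm1 porbit_id.
  by rewrite expgSr permM; apply: porbit_trans (rs _) IH.
case/porbitP => i e.
apply: (porbit_trans (lr y)); rewrite e; apply: (porbit_trans (l _ _)).
by rewrite porbit_sym.
Qed.

Lemma porbits_insert_lift n (t : 'S_n) j :
  porbits (insert t (lift ord0 j)) = [set retract j @^-1: (c : {set 'I_n}) | c in porbits t].
Proof.
apply/setP => c; apply/imsetP/imsetP => [[x _ ->]|[_ /imsetP[x _ ->] ->]].
  exists (porbit t (retract j x)); first exact: imset_f.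
  by rewrite porbit_insert_lift.
by exists (lift ord0 x); rewrite ?porbit_insert_lift ?retract_lift.
Qed.

Lemma card_retract n (j : 'I_n) (c : {set 'I_n}) :
  #|retract j @^-1: c| = ((j \in c) + #|c|)%N.
Proof.
rewrite (cardsD1 ord0) inE retract0; congr (_ + _)%N.
rewrite -[RHS](card_imset _ (@lift_inj _ ord0)); apply: eq_card => x.
rewrite !inE; case: (unliftP ord0 x) => [y ->|->].
  by rewrite retract_lift eq_sym neq_lift (mem_imset _ _ lift_inj).
by rewrite eqxx; apply/esym/negP => /imsetP[y _ /eqP]; rewrite (negPf (neq_lift _ _)).
Qed.

Lemma preimset_retract_inj n (j : 'I_n) :
  injective (fun c : {set 'I_n} => retract j @^-1: c).
Proof.
by move=> c d /setP e; apply/setP => x; have := e (lift ord0 x); rewrite !inE retract_lift.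
Qed.

Lemma perm_enum_imset (T U : finType) (f : T -> U) (A : {set T}) :
  injective f -> perm_eq (enum (f @: A)) (map f (enum A)).
Proof.
move=> fI; apply: uniq_perm; rewrite ?map_inj_uniq ?enum_uniq // => x.
rewrite mem_enum; apply/imsetP/mapP => -[y Ay ->]; exists y => //; move: Ay; by rewrite mem_enum.
Qed.

Lemma cycle_lengths_insert_lift n (t : 'S_n) j :
  perm_eq (cycle_lengths (insert t (lift ord0 j)))
    [seq ((j \in c) + #|c|)%N | c : {set 'I_n} <- enum (porbits t)].
Proof.
rewrite /cycle_lengths porbits_insert_lift.
have /(perm_map (fun c : {set _} => #|c|)) := perm_enum_imset (porbits t) (@preimset_retract_inj _ j).
move/perm_trans; apply; rewrite -map_comp.
by under eq_map do rewrite /= card_retract.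
Qed.

Lemma porbit_insert0 n (t : 'S_n) x :
  porbit (insert t ord0) (lift ord0 x) = lift ord0 @: porbit t x.
Proof.
have e i y : ((insert t ord0) ^+ i)%g (lift ord0 y) = lift ord0 ((t ^+ i)%g y).
  elim: i => [|i IH]; first by rewrite !expg0 !perm1.
  by rewrite expgSr permM IH insert_lift tperm1 perm1 expgSr permM.
apply/setP => y; apply/porbitP/imsetP => [[i ->]|[_ /porbitP[i ->] ->]].
  by exists ((t ^+ i)%g x); rewrite ?mem_porbit // e.
by exists i; rewrite e.
Qed.

Lemma porbit_insert00 n (t : 'S_n) : porbit (insert t ord0) ord0 = [set ord0].
Proof.
apply/setP => y; rewrite inE; apply/porbitP/eqP => [[i ->]|->]; last first.
  by exists 0%N; rewrite expg0 perm1.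
elim: i => [|i IH]; first by rewrite expg0 perm1.
by rewrite expgSr permM IH insert_ord0.
Qed.

Lemma cycle_lengths_insert0 n (t : 'S_n) :
  perm_eq (cycle_lengths (insert t ord0)) (1%N :: cycle_lengths t).
Proof.
pose f (c : {set 'I_n}) : {set 'I_n.+1} := lift ord0 @: c.
have fI : injective f by apply: imset_inj; apply: lift_inj.
have e : porbits (insert t ord0) = [set ord0] |: f @: porbits t.
  apply/setP => c; rewrite !inE; apply/imsetP/orP => [[x _ ->]|].
    case: (unliftP ord0 x) => [y ->|->]; last by rewrite porbit_insert00; left.
    by right; rewrite porbit_insert0 (imset_f f) // imset_f.
  case=> [/eqP ->|/imsetP[_ /imsetP[x _ ->] ->]].
    by exists ord0; rewrite ?porbit_insert00.
  by exists (lift ord0 x); rewrite // porbit_insert0.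
have p : perm_eq (enum (porbits (insert t ord0))) ([set ord0] :: map f (enum (porbits t))).
  apply: uniq_perm; rewrite ?enum_uniq //=.
    rewrite map_inj_uniq // enum_uniq andbT; apply/negP => /mapP[c _ /setP/(_ ord0)].
    rewrite !inE eqxx => /esym/imsetP[y _ /eqP]; by rewrite (negPf (neq_lift _ _)).
  move=> c; rewrite mem_enum e !inE; congr (_ || _).
  apply/imsetP/mapP => -[d dp ->]; exists d => //; move: dp; by rewrite mem_enum.
have := perm_map (fun c : {set _} => #|c|) p => /perm_trans; apply.
rewrite /= cards1 -map_comp perm_cons /cycle_lengths.
rewrite (@eq_map _ _ _ (fun c : {set 'I_n} => #|c|)) // => c.
by rewrite /= card_imset //; apply: lift_inj.
Qed.

Lemma trivIset_porbits n (s : 'S_n) : finset.trivIset (porbits s).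
Proof.
apply/finset.trivIsetP => _ _ /imsetP[x _ ->] /imsetP[y _ ->].
rewrite -setI_eq0; apply: contraNT => /set0Pn[z]; rewrite inE => /andP[].
by rewrite -!eq_porbit_mem => /eqP -> /eqP ->.
Qed.

Lemma cover_porbits n (s : 'S_n) : finset.cover (porbits s) = [set: 'I_n].
Proof.
apply/setP => x; rewrite inE; apply/finset.bigcupP; exists (porbit s x); first exact: imset_f.
exact: porbit_id.
Qed.

Lemma sumn_cycle_lengths n (s : 'S_n) : sumn (cycle_lengths s) = n.
Proof.
rewrite sumnE big_map big_enum /=.
by have := eqP (trivIset_porbits s); rewrite cover_porbits cardsT card_ord.
Qed.

End Insertion.

(** * Weighted sums over cycle types *)

Section CycleSums.
Set Implicit Arguments.
Unset Strict Implicit.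
Variables (R : numFieldType) (theta : R).
Implicit Types (n : nat) (l : seq nat) (Phi : seq nat -> R) (g : nat -> seq nat -> R).

Definition symmetric_fun Phi := forall l l', perm_eq l l' -> Phi l = Phi l'.

Definition cycle_sum n Phi : R :=
  \sum_(s : 'S_n) theta ^+ #|porbits s| * Phi (cycle_lengths s).

(** The operator dual to the insertion of a point: it opens a new cycle with
weight [theta], or enlarges a cycle of length x in x possible ways. *)
Definition grow Phi l : R :=
  theta * Phi (1%N :: l) + \sum_(x <- l) x%:R * Phi (x.+1 :: rem x l).

Lemma perm_rem (T : eqType) (x : T) (l l' : seq T) :
  perm_eq l l' -> perm_eq (rem x l) (rem x l').
Proof.
move=> e; have [xl|xl] := boolP (x \in l); last first.
  by rewrite !rem_id // -(perm_mem e).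
rewrite -(perm_cons x) -(permPl (perm_to_rem xl)) (permPl e) perm_to_rem //.
by rewrite -(perm_mem e).
Qed.

Lemma perm_swap (T : eqType) (x y : T) (l : seq T) :
  perm_eq (x :: y :: l) (y :: x :: l).
Proof. exact: permEl (perm_catCA [:: x] [:: y] l). Qed.

Lemma size_cycle_lengths n (s : 'S_n) : size (cycle_lengths s) = #|porbits s|.
Proof. by rewrite size_map -cardE. Qed.

(** A cycle [c] is enlarged by the insertion in front of any of its #|c| points, so
the sum over the points is grouped by the cycles that contain them. *)
Lemma sum_insert_lift n (t : 'S_n) Phi : symmetric_fun Phi ->
  \sum_(j < n) Phi (cycle_lengths (insert t (lift ord0 j))) =
  \sum_(x <- cycle_lengths t) x%:R * Phi (x.+1 :: rem x (cycle_lengths t)).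
Proof.
move=> symPhi; set l := cycle_lengths t.
pose P := porbits t; set s := enum P.
pose F (j : 'I_n) := Phi [seq ((j \in c) + #|c|)%N | c : {set 'I_n} <- s].
rewrite (eq_bigr F) => [|j _]; last exact/symPhi/cycle_lengths_insert_lift.
rewrite (eq_bigl [in finset.cover P]) => [|j]; last by rewrite cover_porbits inE.
rewrite finset.big_trivIset /=; last exact: trivIset_porbits.
rewrite big_map big_enum /=; apply: eq_bigr => c cP.
rewrite (eq_bigr (fun=> Phi (#|c|.+1 :: rem #|c| l))).
  by rewrite sumr_const mulr_natl.
move=> j jc; apply: symPhi.
have cs : c \in s by rewrite mem_enum.
have pc := perm_to_rem cs.
rewrite (permPl (perm_map _ pc)) /= jc add1n perm_cons.
have -> : [seq ((j \in d) + #|d|)%N | d : {set 'I_n} <- rem c s] =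
    [seq #|d| | d : {set 'I_n} <- rem c s].
  apply/eq_in_map => d; rewrite mem_rem_uniq ?enum_uniq // inE mem_enum => /andP[dc dP].
  have /finset.trivIsetP/(_ _ _ dP cP dc) := trivIset_porbits t.
  by rewrite disjoint_sym => /disjointFr ->.
rewrite -(perm_cons #|c|) -/(map (fun d : {set 'I_n} => #|d|) (c :: rem c s)).
rewrite -(permPl (perm_map _ pc)); apply: perm_to_rem.
exact: map_f.
Qed.

Lemma cycle_sum0 Phi : cycle_sum 0 Phi = Phi [::].
Proof.
have e (s : 'S_0) : porbits s = finset.set0.
  by apply/eqP; rewrite -finset.subset0; apply/fintype.subsetP => c /imsetP[[]].
rewrite /cycle_sum (eq_bigr (fun=> Phi [::])) => [|s _]; last first.
  by rewrite /cycle_lengths e cards0 expr0 mul1r enum_set0.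
by rewrite sumr_const card_Sn.
Qed.

Lemma cycle_sumS n Phi : symmetric_fun Phi -> cycle_sum n.+1 Phi = cycle_sum n (grow Phi).
Proof.
move=> symPhi.
(* The weight depends only on the number of cycles, hence on the list of lengths. *)
pose Psi l := theta ^+ size l * Phi l.
have symPsi : symmetric_fun Psi.
  by move=> l l' e; rewrite /Psi (perm_size e) (symPhi _ _ e).
rewrite /cycle_sum (eq_bigr (fun s => Psi (cycle_lengths s))); last first.
  by move=> s _; rewrite /Psi size_cycle_lengths.
rewrite (reindex _ (onW_bij _ (insert_bij n))) /=.
rewrite -(pair_bigA _ (fun t j => Psi (cycle_lengths (insert t j)))) /=.
apply: eq_bigr => t _; rewrite big_ord_recl sum_insert_lift //.
rewrite (symPsi _ _ (cycle_lengths_insert0 t)) /grow /Psi /= mulrDr size_cycle_lengths.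
congr (_ + _); first by rewrite exprSr mulrA.
rewrite mulr_sumr; apply: eq_big_seq => x xl.
have := perm_size (perm_to_rem xl) => /= <-; rewrite size_cycle_lengths.
by rewrite mulrCA.
Qed.

(** Divided by n!, the weighted sums are coefficients of exponential generating
functions, and the removal of a cycle becomes a convolution. *)
Definition cycle_coef n Phi : R := cycle_sum n Phi / n`!%:R.

Lemma cycle_coef0 Phi : cycle_coef 0 Phi = Phi [::].
Proof. by rewrite /cycle_coef cycle_sum0 divr1. Qed.

Lemma cycle_coefS n Phi : symmetric_fun Phi ->
  n.+1%:R * cycle_coef n.+1 Phi = cycle_coef n (grow Phi).
Proof.
move=> symPhi; rewrite /cycle_coef cycle_sumS // factS natrM invfM.
by rewrite mulrCA mulVKf ?pnatr_eq0.
Qed.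

Lemma eq_cycle_coef n Phi Psi : (forall l, sumn l = n -> Phi l = Psi l) ->
  cycle_coef n Phi = cycle_coef n Psi.
Proof.
move=> e; congr (_ / _); apply: eq_bigr => s _.
by rewrite e // sumn_cycle_lengths.
Qed.

Lemma cycle_coefD n Phi Psi :
  cycle_coef n (fun l => Phi l + Psi l) = cycle_coef n Phi + cycle_coef n Psi.
Proof.
rewrite /cycle_coef -mulrDl -big_split /=; congr (_ / _).
by apply: eq_bigr => s _; rewrite mulrDr.
Qed.

Lemma cycle_coefZ n c Phi :
  cycle_coef n (fun l => c * Phi l) = c * cycle_coef n Phi.
Proof.
rewrite /cycle_coef mulrA; congr (_ / _); rewrite mulr_sumr.
by apply: eq_bigr => s _; rewrite mulrCA.
Qed.

Lemma symmetric_cons k Phi : symmetric_fun Phi -> symmetric_fun (fun l => Phi (k :: l)).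
Proof. by move=> symPhi l l' e; apply: symPhi; rewrite perm_cons. Qed.

Lemma symmetric_marked g : (forall k, symmetric_fun (g k)) ->
  symmetric_fun (fun l => \sum_(x <- l) x%:R * g x (rem x l)).
Proof.
move=> symg l l' e; rewrite (perm_big _ e) /=; apply: eq_bigr => x _.
by rewrite (symg x _ _ (perm_rem x e)).
Qed.

Lemma symmetric_grow Phi : symmetric_fun Phi -> symmetric_fun (grow Phi).
Proof.
move=> symPhi l l' e; rewrite /grow.
rewrite (symPhi (1%N :: l) (1%N :: l')) ?perm_cons //; congr (_ + _).
by apply: (symmetric_marked (g := fun x l => Phi (x.+1 :: l))) e => k; exact: symmetric_cons.
Qed.

Lemma marked_cons g k l : (forall k, symmetric_fun (g k)) ->
  \sum_(x <- k :: l) x%:R * g x (rem x (k :: l)) =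
  k%:R * g k l + \sum_(x <- l) x%:R * g x (k :: rem x l).
Proof.
move=> symg; rewrite big_cons /= eqxx; congr (_ + _).
apply: eq_big_seq => x xl; congr (_ * _); case: eqP => // ->.
by apply: symg; rewrite perm_to_rem.
Qed.

Lemma grow_cons k Phi l : symmetric_fun Phi ->
  grow Phi (k :: l) = k%:R * Phi (k.+1 :: l) + grow (fun l => Phi (k :: l)) l.
Proof.
move=> symPhi; rewrite /grow.
rewrite (@marked_cons (fun x l => Phi (x.+1 :: l))) => [|x]; last exact: symmetric_cons.
rewrite addrCA; congr (_ + (_ + _)).
  by congr (_ * _); apply: symPhi; exact: perm_swap.
apply: eq_bigr => x _; congr (_ * _); apply: symPhi.
exact: perm_swap.
Qed.

(** The cycle that contains a given point has length k + 1, and the remaining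
points carry an arbitrary permutation. By induction on n: the point added by
[grow] either joins the cycle singled out ([grow_cons]), or is inserted in the
rest, where [cycle_coefS] applies; the two contributions add up to the factor
(k + (n + 1 - k)). *)
Lemma cycle_coef_first n Phi : symmetric_fun Phi ->
  n%:R * cycle_coef n Phi =
  theta * \sum_(k < n) cycle_coef (n - k.+1) (fun l => Phi (k.+1 :: l)).
Proof.
case: n => [|n]; first by rewrite mul0r big_ord0 mulr0.
elim: n Phi => [|n IH] Phi symPhi; rewrite cycle_coefS //.
  by rewrite big_ord_recl big_ord0 subnn !cycle_coef0 /grow big_nil !addr0.
apply: (mulfI (x := n.+1%:R)); first by rewrite pnatr_eq0.
rewrite IH; last exact: symmetric_grow.
rewrite mulrCA; congr (_ * _).
pose f k := cycle_coef (n.+1 - k) (fun l => Phi (k.+1 :: l)).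
have e (k : 'I_n.+1) : cycle_coef (n.+1 - k.+1) (fun l => grow Phi (k.+1 :: l)) =
    k.+1%:R * f k.+1 + (n.+1 - k)%:R * f k.
  rewrite (@eq_cycle_coef _ _ (fun l => k.+1%:R * Phi (k.+2 :: l) +
     grow (fun l => Phi (k.+1 :: l)) l)) => [|l _]; last exact: grow_cons.
  rewrite cycle_coefD cycle_coefZ; congr (_ + _).
  by rewrite -cycle_coefS ?/f -?subSn //; exact: symmetric_cons.
rewrite (eq_bigr _ (fun k _ => e k)) big_split /=.
have -> : \sum_(k < n.+1) k.+1%:R * f k.+1 = \sum_(k < n.+2) k%:R * f k.
  by rewrite [RHS]big_ord_recl mul0r add0r.
have -> : \sum_(k < n.+1) (n.+1 - k)%:R * f k = \sum_(k < n.+2) (n.+1 - k)%:R * f k.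
  by rewrite [RHS]big_ord_recr /= subnn mul0r addr0.
rewrite -big_split mulr_sumr; apply: eq_bigr => k _ /=.
by rewrite -mulrDl -natrD subnKC // -ltnS.
Qed.

(** The bound [N] only has to be large enough for both sides to range over the
whole triangle k + j < n. *)
Lemma exchange_triangle (V : nmodType) N n (F : nat -> nat -> V) : (n <= N)%N ->
  \sum_(k < N) \sum_(j < n - k) F k j = \sum_(j < N) \sum_(k < n - j) F k j.
Proof.
move=> nN; have w k (G : nat -> V) : \sum_(j < n - k) G j = \sum_(j < N | (j < n - k)%N) G j.
  by rewrite (big_ord_widen N) // (leq_trans (leq_subr _ _)).
rewrite (eq_bigr _ (fun (k : 'I_N) _ => w k (F k))).
rewrite (exchange_big_dep predT) //=; apply: eq_bigr => j _.
by rewrite (w j (F^~ j)); apply: eq_bigl => k; rewrite !ltn_subRL addnC.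
Qed.

(** A sum over all cycles, each counted with its length, is a sum over all points:
by symmetry it is n times the contribution of the cycle of a single point.
The proof removes the cycle of one point and, by induction, marks a cycle of
the rest, then exchanges the two removed cycles. *)
Lemma cycle_coef_marked n g : (forall k, symmetric_fun (g k)) ->
  cycle_coef n (fun l => \sum_(x <- l) x%:R * g x (rem x l)) =
  theta * \sum_(k < n) cycle_coef (n - k.+1) (g k.+1).
Proof.
elim/ltn_ind: n g => -[|n] IH g symg.
  by rewrite cycle_coef0 big_nil big_ord0 mulr0.
apply: (mulfI (x := n.+1%:R)); first by rewrite pnatr_eq0.
rewrite cycle_coef_first; last exact: symmetric_marked.
rewrite mulrCA; congr (_ * _).
have e (k : 'I_n.+1) :
    cycle_coef (n.+1 - k.+1) (fun l => \sum_(x <- k.+1 :: l) x%:R * g x (rem x (k.+1 :: l))) =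
    k.+1%:R * cycle_coef (n.+1 - k.+1) (g k.+1) +
    theta * \sum_(j < n - k) cycle_coef (n - k - j.+1) (fun l => g j.+1 (k.+1 :: l)).
  rewrite (eq_cycle_coef (fun l _ => marked_cons k.+1 l symg)).
  rewrite cycle_coefD cycle_coefZ subSS (IH (n - k)%N _ (fun x l => g x (k.+1 :: l))) //.
    by rewrite ltnS leq_subr.
  by move=> x; exact: symmetric_cons.
rewrite (eq_bigr _ (fun k _ => e k)) big_split /= -mulr_sumr.
rewrite (@exchange_triangle _ _ _
  (fun k j => cycle_coef (n - k - j.+1) (fun l => g j.+1 (k.+1 :: l)))) //.
rewrite [theta * _]mulr_sumr -big_split mulr_sumr /=; apply: eq_bigr => j _.
rewrite (eq_bigr (fun k : 'I__ => cycle_coef (n - j - k.+1) (fun l => g j.+1 (k.+1 :: l)))).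
  by rewrite -cycle_coef_first // -mulrDl subSS -natrD addSn subnKC // -ltnS.
by move=> k _; rewrite -!subnDA !addnS addnC.
Qed.

End CycleSums.

(** * The longest cycle *)

Section Longest.
Set Implicit Arguments.
Unset Strict Implicit.
Implicit Types (l : seq nat) (m n k x : nat).

Definition longest l : nat := \max_(x <- l) x.

Lemma longest_cons x l : longest (x :: l) = maxn x (longest l).
Proof. exact: big_cons. Qed.

Lemma longest_perm l l' : perm_eq l l' -> longest l = longest l'.
Proof. exact: perm_big. Qed.

Lemma leq_longest x l : x \in l -> (x <= longest l)%N.
Proof. by move=> xl; rewrite (longest_perm (perm_to_rem xl)) longest_cons leq_maxl. Qed.

Lemma longest_mem l : (0 < longest l)%N -> longest l \in l.
Proof.
elim: l => [|x l IH]; first by rewrite /longest big_nil.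
rewrite longest_cons inE; case: (leqP (longest l) x) => [le|lt] h.
  by rewrite eqxx.
by rewrite IH ?orbT // (leq_ltn_trans _ lt).
Qed.

(** Decreasing an entry of the list lowers the maximum only if that entry is the
unique maximum M, and then by at most one; this concerns M of the n + 1 units. *)
Lemma longest_shrink n l : sumn l = n.+1 ->
  (n * longest l <= \sum_(x <- l) x * longest (x.-1 :: rem x l))%N.
Proof.
move=> sl; have [->|h] := posnP (longest l); first by rewrite muln0.
have pl := perm_to_rem (longest_mem h).
set M := longest l in h pl *; set r := rem M l in pl.
rewrite (perm_big _ pl) big_cons /= -/r.
have -> : n = (M.-1 + sumn r)%N.
  apply/succn_inj; rewrite -sl !sumnE (perm_big _ pl) big_cons /=.
  by rewrite -addSn prednK.
rewrite mulnDl; apply: leq_add.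
  by rewrite mulnC leq_mul2l longest_cons leq_maxl orbT.
rewrite sumnE big_distrl /= big_seq [leqRHS]big_seq; apply: leq_sum => x xr.
suff Mx : M \in rem x l by rewrite leq_mul2l longest_cons leq_max (leq_longest Mx) !orbT.
have [xM|xM] := eqVneq x M; first by move: xr; rewrite /r xM.
by rewrite (perm_mem (perm_rem x pl)) /= eq_sym (negPf xM) mem_head.
Qed.

(** At most one entry exceeds all the others, and it is the maximum. *)
Lemma longest_unique_le l :
  (\sum_(x <- l) x * all (leq^~ x.-1) (rem x l) <= longest l)%N.
Proof.
have [/hasP[x xl /andP[x0 ax]]|/hasPn h] :=
    boolP (has (fun x => (0 < x) && all (leq^~ x.-1) (rem x l))%N l); last first.
  rewrite big1_seq // => x /andP[_ xl]; have := h x xl.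
  by rewrite negb_and -eqn0Ngt => /orP[/eqP ->|/negPf ->]; rewrite ?muln0.
have pl := perm_to_rem xl; set r := rem x l in ax pl.
rewrite (perm_big _ pl) big_cons ax muln1 big1_seq /=; first by rewrite addn0 leq_longest.
move=> y yr; have /= yx := allP ax y yr.
have ne : x != y by lia.
have xin : x \in rem y l by rewrite (perm_mem (perm_rem y pl)) /= (negPf ne) mem_head.
suff /negPf -> : ~~ all (leq^~ y.-1) (rem y l) by rewrite muln0.
by apply/negP => /allP/(_ _ xin); rewrite leqNgt => /negP; lia.
Qed.

Lemma longest_le_all l :
  (longest l <= \sum_(x <- l) x * all (leq^~ x) (rem x l))%N.
Proof.
have [->//|h] := posnP (longest l).
rewrite (perm_big _ (perm_to_rem (longest_mem h))) big_cons.
suff -> : all (leq^~ (longest l)) (rem (longest l) l) by rewrite muln1 leq_addr.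
by apply/allP => x /mem_rem; exact: leq_longest.
Qed.

End Longest.

Section LongestCoefs.
Set Implicit Arguments.
Unset Strict Implicit.
Variables (R : realFieldType) (theta : R).
Hypothesis theta_gt0 : 0 < theta.
Implicit Types (m n : nat) (l : seq nat) (Phi Psi : seq nat -> R).
Local Notation coef := (cycle_coef theta).

Lemma le_cycle_coef n Phi Psi : (forall l, sumn l = n -> Phi l <= Psi l) ->
  coef n Phi <= coef n Psi.
Proof.
move=> le; rewrite /cycle_coef ler_pM2r ?invr_gt0 ?ltr0n ?fact_gt0 //.
apply: ler_sum => s _; apply: ler_wpM2l; first by rewrite exprn_ge0 // ltW.
by rewrite le // sumn_cycle_lengths.
Qed.

Definition total_coef n : R := coef n (fun=> 1).

Definition bounded_coef m n : R := coef n (fun l => (all (leq^~ m) l)%:R).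

Definition longest_coef n : R := coef n (fun l => (longest l)%:R).

Lemma symmetric_longest : symmetric_fun (fun l => (longest l)%:R : R).
Proof. by move=> l l' e; rewrite (longest_perm e). Qed.

Lemma symmetric_all m : symmetric_fun (fun l => (all (leq^~ m) l)%:R : R).
Proof. by move=> l l' e; rewrite (perm_all _ e). Qed.

Lemma total_coef0 : total_coef 0 = 1.
Proof. exact: cycle_coef0. Qed.

Lemma total_coefS n : n.+1%:R * total_coef n.+1 = (theta + n%:R) * total_coef n.
Proof.
rewrite /total_coef cycle_coefS // -cycle_coefZ; apply: eq_cycle_coef => l ln.
rewrite /grow !mulr1; congr (_ + _); under eq_bigr do rewrite mulr1.
by rewrite -natr_sum -sumnE ln.
Qed.

Lemma total_coef_gt0 n : 0 < total_coef n.
Proof.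
elim: n => [|n IH]; first by rewrite total_coef0.
by rewrite -(pmulr_rgt0 _ (ltr0Sn _ n)) total_coefS mulr_gt0 // ltr_wpDr ?ler0n.
Qed.

Lemma total_coef_fact n : n`!%:R * total_coef n = \prod_(i < n) (theta + i%:R).
Proof.
elim: n => [|n IH]; first by rewrite total_coef0 big_ord0 mulr1.
by rewrite big_ord_recr /= -IH factS mulnC natrM -mulrA total_coefS mulrCA mulrC.
Qed.

Lemma total_coef_first n : n%:R * total_coef n = theta * \sum_(k < n) total_coef (n - k.+1).
Proof. exact: cycle_coef_first. Qed.

Lemma bounded_coef0 m : bounded_coef m 0 = 1.
Proof. exact: cycle_coef0. Qed.

Lemma bounded_coef_ge0 m n : 0 <= bounded_coef m n.
Proof.
rewrite -[leLHS](mul0r (coef n (fun=> 1))) -cycle_coefZ.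
by apply: le_cycle_coef => l _; rewrite mul0r ler0n.
Qed.

Lemma bounded_coef_le_total m n : bounded_coef m n <= total_coef n.
Proof. by apply: le_cycle_coef => l _; rewrite lern1 leq_b1. Qed.

Lemma bounded_coef_total m n : (n <= m)%N -> bounded_coef m n = total_coef n.
Proof.
move=> nm; apply: eq_cycle_coef => l ln; suff -> : all (leq^~ m) l by [].
by apply/allP => x /perm_to_rem/perm_sumn /= e; move: nm; rewrite -ln e; lia.
Qed.

Lemma bounded_coef_first m n : n%:R * bounded_coef m n =
  theta * \sum_(k < n | (k < m)%N) bounded_coef m (n - k.+1).
Proof.
rewrite cycle_coef_first; last exact: symmetric_all.
congr (_ * _); rewrite [RHS]big_mkcond; apply: eq_bigr => k _ /=.
case: (k < m)%N; first exact: eq_cycle_coef.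
by rewrite (@eq_cycle_coef _ _ _ _ (fun=> 0 * 1)) ?cycle_coefZ ?mul0r // => l _; rewrite mul0r.
Qed.

Lemma longest_coef_ge0 n : 0 <= longest_coef n.
Proof.
rewrite -[leLHS](mul0r (coef n (fun=> 1))) -cycle_coefZ.
by apply: le_cycle_coef => l _; rewrite mul0r ler0n.
Qed.

(** Decreasing the marked cycle by one amounts to deleting the marked point. By
[cycle_coef_marked] this yields a sum over k whose term k = 0, where a fixed
point disappears, equals theta [longest_coef] n and whose other terms are the
expansion of n [longest_coef] n around a marked point; [longest_shrink] compares
the result with n [longest_coef] (n + 1). *)
Lemma longest_coefS n : n%:R * longest_coef n.+1 <= (theta + n%:R) * longest_coef n.
Proof.
pose g x l : R := (longest (x.-1 :: l))%:R.
have symg x : symmetric_fun (g x).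
  by move=> l l' e; rewrite /g (@longest_perm (x.-1 :: l) (x.-1 :: l')) ?perm_cons.
apply: (@le_trans _ _ (coef n.+1 (fun l => \sum_(x <- l) x%:R * g x (rem x l)))).
  rewrite -cycle_coefZ; apply: le_cycle_coef => l ln.
  rewrite /g -natrM; under eq_bigr do rewrite -natrM.
  by rewrite -natr_sum ler_nat longest_shrink.
rewrite cycle_coef_marked // big_ord_recl subSS subn0 mulrDl mulrDr.
rewrite [n%:R * _]cycle_coef_first; last exact: symmetric_longest.
apply: lerD; last exact: lexx.
rewrite (@eq_cycle_coef _ _ _ _ (fun l => (longest l)%:R)) // => l _.
by rewrite /g longest_cons max0n.
Qed.


(** In this and the next lemma the marked cycle has length k + 1, and the rest of
the permutation must consist of cycles strictly shorter, respectively not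
longer, than the marked one. *)
Lemma longest_coef_ge n :
  theta * \sum_(k < n) bounded_coef k (n - k.+1) <= longest_coef n.
Proof.
pose g x l : R := (all (leq^~ x.-1) l)%:R.
rewrite -(@cycle_coef_marked _ _ _ g) => [|k]; last exact: symmetric_all.
apply: le_cycle_coef => l _; rewrite /g; under eq_bigr do rewrite -natrM.
by rewrite -natr_sum ler_nat longest_unique_le.
Qed.

Lemma longest_coef_le n :
  longest_coef n <= theta * \sum_(k < n) bounded_coef k.+1 (n - k.+1).
Proof.
pose g x l : R := (all (leq^~ x) l)%:R.
rewrite -(@cycle_coef_marked _ _ _ g) => [|k]; last exact: symmetric_all.
apply: le_cycle_coef => l _; rewrite /g; under [leRHS]eq_bigr do rewrite -natrM.
by rewrite -natr_sum ler_nat longest_le_all.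
Qed.

End LongestCoefs.

(** * Monotonicity of the mean of the longest cycle *)

Section MeanRatio.
Set Implicit Arguments.
Unset Strict Implicit.
Variables (R : realType) (theta : R).
Hypothesis theta_gt0 : 0 < theta.

Lemma ewens_longest n :
  ewens_expectation theta (fun s : 'S_n => (longest_cycle s)%:R) =
  longest_coef theta n / total_coef theta n.
Proof.
have n0 : n`!%:R != 0 :> R by rewrite pnatr_eq0 -lt0n fact_gt0.
rewrite /ewens_expectation /ewens -total_coef_fact /longest_coef /cycle_coef.
rewrite -mulrA -invfM mulr_suml; apply: eq_bigr => s _.
by rewrite /longest /cycle_lengths big_map big_enum /= mulrCA mulrA.
Qed.

Definition mean_ratio n : R := longest_coef theta n / (n%:R * total_coef theta n).

Lemma mean_ratio_ge0 n : 0 <= mean_ratio n.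
Proof. by rewrite divr_ge0 ?longest_coef_ge0 // mulr_ge0 ?ler0n // ltW // total_coef_gt0. Qed.

Lemma mean_ratioS n : mean_ratio n.+2 <= mean_ratio n.+1.
Proof.
have w0 : 0 < total_coef theta n.+1 by exact: total_coef_gt0.
rewrite /mean_ratio total_coefS // invfM ler_pdivlMr; last by rewrite mulr_gt0 ?ltr0n.
set t := theta + _; have t0 : 0 < t by rewrite ltr_wpDr ?ler0n.
rewrite -[leLHS](_ : n.+1%:R * longest_coef theta n.+2 / t = _); last first.
  by field; rewrite ?gt_eqF ?ltr0n.
by rewrite ler_pdivrMr // [leRHS]mulrC longest_coefS.
Qed.

End MeanRatio.

(** * Generating functions with nonnegative coefficients *)

Local Open Scope classical_set_scope.
Local Open Scope ring_scope.

Section GeneratingFunctions.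
Set Implicit Arguments.
Unset Strict Implicit.
Variable R : realType.
Implicit Types (a e : nat -> R) (f : nat -> nat -> R) (phi : nat -> nat) (x : R).
Local Open Scope ereal_scope.

(** Tonelli for series, with the k-th series shifted by [phi k]. The condition
k <= phi k makes the sum over k finite for each n; the shifts k + 1 and
k * (m + 1) are the ones used below. *)
Lemma nneseries_antidiagonal f phi : (forall k j, 0 <= f k j)%R ->
  (forall k, k <= phi k)%N ->
  \sum_(n <oo) (\sum_(k < n.+1 | (phi k <= n)%N) f k (n - phi k)%N)%:E =
  \sum_(k <oo) \sum_(j <oo) (f k j)%:E.
Proof.
move=> f0 phik.
pose a n k : \bar R := if (phi k <= n)%N then (f k (n - phi k)%N)%:E else 0.
have a0 n k : 0 <= a n k by rewrite /a; case: ifP => // _; rewrite lee_fin.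
transitivity (\sum_(n <oo) \sum_(k <oo) a n k).
  apply: eq_eseriesr => n _; rewrite (nneseries_split 0 n.+1) // add0n eseries0 => [|k nk _].
    by rewrite adde0 big_mkord -sumEFin big_mkcond.
  by rewrite /a leqNgt (leq_trans nk) // phik.
rewrite nneseries_interchange //; apply: eq_eseriesr => k _.
rewrite (nneseries_split 0 (phi k)) // add0n big1_seq ?add0e => [|n /andP[_]]; last first.
  by rewrite mem_index_iota /= /a => nk; rewrite leqNgt nk.
rewrite -nneseries_addn //; apply: eq_eseriesr => j _.
by rewrite /a leq_addl addnK.
Qed.

(** Values are extended reals: for nonnegative coefficients the sum always exists,
so that series can be rearranged before their convergence is known. *)
Definition genfun a x : \bar R := \sum_(n <oo) (a n * x ^+ n)%:E.

Lemma genfun_ge0 a x : (forall n, 0 <= a n)%R -> (0 <= x)%R -> 0 <= genfun a x.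
Proof. by move=> a0 x0; apply: nneseries_ge0 => n _ _; rewrite lee_fin mulr_ge0 // exprn_ge0. Qed.

Lemma le_gf a b x : (0 <= x)%R -> (forall n, 0 <= a n <= b n)%R -> genfun a x <= genfun b x.
Proof.
move=> x0 ab; apply: lee_nneseries => n; rewrite lee_fin.
  by move=> _ _; case/andP: (ab n) => a0 _; rewrite mulr_ge0 // exprn_ge0.
by move=> _; case/andP: (ab n) => _ h; rewrite ler_wpM2r // exprn_ge0.
Qed.

Lemma genfunZ c a x : (0 <= x)%R -> (forall n, 0 <= a n)%R ->
  genfun (fun n => c * a n)%R x = c%:E * genfun a x.
Proof.
move=> x0 a0; rewrite -nneseriesZl => [|n _]; last by rewrite lee_fin mulr_ge0 // exprn_ge0.
by apply: eq_eseriesr => n _; rewrite -mulrA EFinM.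
Qed.

Lemma genfun_antidiagonal f phi x : (0 <= x)%R -> (forall k j, 0 <= f k j)%R ->
  (forall k, k <= phi k)%N ->
  genfun (fun n => \sum_(k < n.+1 | (phi k <= n)%N) f k (n - phi k)%N)%R x =
  \sum_(k <oo) ((x ^+ phi k)%:E * genfun (f k) x).
Proof.
move=> x0 f0 phik.
transitivity (\sum_(k <oo) \sum_(j <oo) (x ^+ phi k * (f k j * x ^+ j))%:E).
  rewrite -(@nneseries_antidiagonal (fun k j => x ^+ phi k * (f k j * x ^+ j))%R phi) //.
    apply: eq_eseriesr => n _; congr (_%:E); rewrite mulr_suml; apply: eq_bigr => k kn.
    by rewrite mulrCA -exprD subnKC.
  by move=> k j; rewrite !mulr_ge0 // exprn_ge0.
apply: eq_eseriesr => k _; rewrite -nneseriesZl => [|n _].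
  by apply: eq_eseriesr => n _; rewrite EFinM.
by rewrite lee_fin mulr_ge0 // exprn_ge0.
Qed.

Lemma genfun_shifts f x : (0 <= x)%R -> (forall k j, 0 <= f k j)%R ->
  genfun (fun n => \sum_(k < n) f k (n - k.+1)%N)%R x =
  \sum_(k <oo) ((x ^+ k.+1)%:E * genfun (f k) x).
Proof.
move=> x0 f0; rewrite -(genfun_antidiagonal (phi := succn)) //.
apply: eq_eseriesr => n _; congr (_ * _)%:E.
by rewrite (big_ord_widen n.+1 (fun k => f k (n - k.+1)%N)).
Qed.

Lemma nneseries_expR x : (0 <= x)%R -> \sum_(n <oo) (x ^+ n / n`!%:R)%:E = (expR x)%:E.
Proof.
move=> x0; rewrite /expR -EFin_lim; last exact: is_cvg_series_exp_coeff.
by apply: congr_lim; apply/funext => n; rewrite /= sumEFin.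
Qed.

Lemma nneseries_geometric x : (0 <= x < 1)%R ->
  \sum_(n <oo) (x ^+ n)%:E = (1 - x)^-1%:E.
Proof.
move=> /andP[x0 x1].
have := @cvg_geometric_series R 1 x; rewrite ger0_norm // => /(_ x1) h.
have := cvg_lim (@Rhausdorff R) h; rewrite mul1r => <-.
rewrite -EFin_lim; last by apply/cvg_ex; eexists; exact: h.
apply: congr_lim; apply/funext => n; rewrite /= sumEFin; congr (_%:E).
by apply: eq_bigr => i _; rewrite /= mul1r.
Qed.

End GeneratingFunctions.

(** * Generating function of the permutations with short cycles *)

Section CycleGF.
Set Implicit Arguments.
Unset Strict Implicit.
Variables (R : realType) (theta : R).
Hypothesis theta_gt0 : 0 < theta.
Implicit Types (m n : nat) (x : R).
Local Notation bounded := (bounded_coef theta).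
Local Notation total := (total_coef theta).

(** Coefficient n of x^p times the generating function of [bounded_coef m]. *)
Definition shifted m n p : R := if (p <= n)%N then bounded m (n - p) else 0.

Lemma shifted_rec m n p :
  (n - p)%:R * shifted m n p = theta * \sum_(k < m) shifted m n (p + k.+1).
Proof.
rewrite /shifted; case: (leqP p n) => [pn|np]; last first.
  rewrite mulr0 big1 ?mulr0 // => k _; by rewrite leqNgt (leq_trans np) ?leq_addr.
rewrite bounded_coef_first //; congr (_ * _).
rewrite (big_ord_widen_cond (n - p + m) (fun k => k < m)%N
  (fun k => bounded m (n - p - k.+1))) ?leq_addr //.
rewrite (big_ord_widen (n - p + m) (fun k => if (p + k.+1 <= n)%N
  then bounded m (n - (p + k.+1)) else 0)) ?leq_addl //.
rewrite big_mkcondr [LHS]big_mkcond [RHS]big_mkcond /=; apply: eq_bigr => k _.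
by case: (k < m)%N => //; rewrite ltn_subRL -addnS subnDA.
Qed.

(** A permutation with cycles of length at most m + 1 consists of some number j of
(m + 1)-cycles and of a permutation with cycles of length at most m. Rather
than by such a decomposition, the identity is proved by checking that its right
hand side c satisfies the recurrence [bounded_coef_first], which determines
[bounded_coef m.+1]. With e_j the coefficients of exp (theta y / (m + 1)), split
n = (n - j (m + 1)) + j (m + 1) in n c_n: the first part gives the terms k < m by
[shifted_rec], the second the term k = m because (j + 1) (m + 1) e_(j+1) = theta e_j. *)
Lemma bounded_coefS m n : bounded m.+1 n =
  \sum_(j < n.+1 | (j * m.+1 <= n)%N)
    (theta / m.+1%:R) ^+ j / j`!%:R * bounded m (n - j * m.+1).
Proof.
pose e j : R := (theta / m.+1%:R) ^+ j / j`!%:R.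
have e0 : e 0%N = 1 by rewrite /e expr0 fact0 divr1.
have eS j : (j.+1 * m.+1)%:R * e j.+1 = theta * e j.
  rewrite /e exprS factS !natrM.
  have f0 : j`!%:R != 0 :> R by rewrite pnatr_eq0 -lt0n fact_gt0.
  have m0 : m.+1%:R != 0 :> R by rewrite pnatr_eq0.
  have j0 : j.+1%:R != 0 :> R by rewrite pnatr_eq0.
  move: (_ ^+ j) f0 m0 j0 => E; move: (j`!%:R) m.+1%:R j.+1%:R => F M J F0 M0 J0.
  by field; rewrite F0 J0 M0.
pose c n := \sum_(j < n.+1) e j * shifted m n (j * m.+1).
have -> : \sum_(j < n.+1 | (j * m.+1 <= n)%N)
    (theta / m.+1%:R) ^+ j / j`!%:R * bounded m (n - j * m.+1) = c n.
  rewrite big_mkcond; apply: eq_bigr => j _; rewrite /shifted.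
  by case: ifP => // _; rewrite mulr0.
have cw N n' : (n' < N)%N -> c n' = \sum_(j < N) e j * shifted m n' (j * m.+1).
  move=> nN; rewrite /c (big_ord_widen N (fun j => e j * shifted m n' (j * m.+1))) //.
  rewrite big_mkcond /=; apply: eq_bigr => j _; case: ltnP => // nj.
  by rewrite /shifted leqNgt (leq_trans nj) ?mulr0 // leq_pmulr.
have crec n' : n'%:R * c n' = theta * \sum_(k < n' | (k < m.+1)%N) c (n' - k.+1)%N.
  have d k : (k < n')%N -> c (n' - k.+1)%N = \sum_(j < n'.+1) e j * shifted m n' (j * m.+1 + k.+1).
    move=> kn; rewrite (@cw n'.+1) ?ltnS ?leq_subr //; apply: eq_bigr => j _; congr (_ * _).
    rewrite /shifted addnC -leq_subRL // subnDA //.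
  have -> : \sum_(k < n' | (k < m.+1)%N) c (n' - k.+1)%N =
      \sum_(k < m.+1) \sum_(j < n'.+1) e j * shifted m n' (j * m.+1 + k.+1).
    rewrite (eq_bigr (fun k : 'I_n' => \sum_(j < n'.+1) e j * shifted m n' (j * m.+1 + k.+1)))
      => [|k _]; last exact: d.
    rewrite (big_ord_widen_cond (n' + m.+1) (fun k => k < m.+1)%N
      (fun k => \sum_(j < n'.+1) e j * shifted m n' (j * m.+1 + k.+1))) ?leq_addr //.
    rewrite [RHS](big_ord_widen (n' + m.+1)
      (fun k => \sum_(j < n'.+1) e j * shifted m n' (j * m.+1 + k.+1))) ?leq_addl //.
    rewrite big_mkcondr; apply: eq_bigr => k _; case: ifP => // /negbT; rewrite -leqNgt => nk.
    rewrite big1 // => j _; rewrite /shifted leqNgt (_ : (n' < _)%N) ?mulr0 //; lia.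
  rewrite /c mulr_sumr [in RHS]big_ord_recr /= mulrDr.
  rewrite [X in theta * X + _]exchange_big /= [theta * \sum_(j < _) _]mulr_sumr.
  rewrite (eq_bigr (fun j : 'I_n'.+1 => theta * (\sum_(k < m) e j * shifted m n' (j * m.+1 + k.+1)) +
     (j * m.+1)%:R * e j * shifted m n' (j * m.+1))); last first.
    move=> j _; rewrite -mulr_sumr [theta * _]mulrCA -shifted_rec.
    rewrite /shifted; case: leqP => [jn|_]; last by rewrite !mulr0 addr0.
    by rewrite natrB //; ring.
  rewrite big_split /=; congr (_ + _).
  rewrite big_ord_recl !mul0n !mul0r add0r.
  have z : shifted m n' (n' * m.+1 + m.+1) = 0.
    by rewrite /shifted mulnS leqNgt (_ : (n' < _)%N) //; lia.
  rewrite [X in _ = theta * X]big_ord_recr /= z mulr0 addr0.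
  rewrite mulr_sumr; apply: eq_bigr => j _.
  by rewrite eS mulrA /bump /= add1n mulSn addnC.
elim/ltn_ind: n => -[|n] IH.
  by rewrite bounded_coef0 /c big_ord_recl big_ord0 e0 /shifted bounded_coef0 mulr1 addr0.
apply: (mulfI (x := n.+1%:R)); first by rewrite pnatr_eq0.
rewrite crec bounded_coef_first; congr (_ * _); apply: eq_bigr => k _.
by rewrite IH // subSS ltnS leq_subr.
Qed.

Lemma genfun_bounded m x : 0 <= x ->
  genfun (bounded m) x = (expR (theta * \sum_(k < m) x ^+ k.+1 / k.+1%:R))%:E.
Proof.
move=> x0; elim: m => [|m IH].
  rewrite big_ord0 mulr0 expR0 /genfun (nneseries_split 0 1); last first.
    by move=> k _; rewrite lee_fin mulr_ge0 ?exprn_ge0 // bounded_coef_ge0.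
  rewrite add0n big_nat1 bounded_coef0 expr0 mulr1 eseries0 ?adde0 // => -[//|k] _ _.
  suff -> : bounded 0 k.+1 = 0 by rewrite mul0r.
  apply: (mulfI (x := k.+1%:R)); first by rewrite pnatr_eq0.
  by rewrite bounded_coef_first big_pred0 // !mulr0.
pose f j i : R := (theta / m.+1%:R) ^+ j / j`!%:R * bounded m i.
have e0 j : 0 <= (theta / m.+1%:R) ^+ j / j`!%:R.
  by rewrite divr_ge0 // exprn_ge0 // divr_ge0 // ltW.
have f0 j i : 0 <= f j i by rewrite mulr_ge0 // bounded_coef_ge0.
transitivity (genfun (fun n => \sum_(j < n.+1 | (j * m.+1 <= n)%N) f j (n - j * m.+1)%N) x).
  by apply: eq_eseriesr => n _; rewrite bounded_coefS.
rewrite (genfun_antidiagonal (phi := fun j => (j * m.+1)%N)) //; last by move=> k; rewrite leq_pmulr.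
set G := genfun (bounded m) x.
rewrite (eq_eseriesr (g := fun j : nat => (expR (theta * \sum_(k < m) x ^+ k.+1 / k.+1%:R))%:E *
  ((theta * (x ^+ m.+1 / m.+1%:R)) ^+ j / j`!%:R)%:E)%E); last first.
  move=> j _; rewrite genfunZ //; last by move=> n; exact: bounded_coef_ge0.
  rewrite -IH -/G muleA -EFinM muleC; congr (_ * _%:E)%E.
  by rewrite [theta * (_ / _)]mulrCA [in RHS]exprMn -exprM [(m.+1 * _)%N]mulnC mulrA.
rewrite nneseriesZl; last first.
  move=> j _; rewrite lee_fin divr_ge0 // exprn_ge0 // mulr_ge0 ?divr_ge0 ?exprn_ge0 //.
  exact: ltW.
rewrite nneseries_expR; last by rewrite mulr_ge0 ?divr_ge0 ?exprn_ge0 // ltW.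
by rewrite -EFinM -expRD big_ord_recr /= mulrDr.
Qed.

Lemma genfun_bounded_le_total m x : 0 <= x -> (genfun (bounded m) x <= genfun total x)%E.
Proof. by move=> x0; apply: le_gf => // n; rewrite bounded_coef_ge0 // bounded_coef_le_total. Qed.

(** The first N coefficients of [total] are those of [bounded N]. *)
Lemma genfun_total_le x (C : \bar R) : 0 <= x ->
  (forall m, genfun (bounded m) x <= C)%E -> (genfun total x <= C)%E.
Proof.
move=> x0 h; apply: lime_le.
  by apply: is_cvg_nneseries => n _ _; rewrite lee_fin mulr_ge0 ?exprn_ge0 // ltW // total_coef_gt0.
apply: nearW => N; apply: le_trans (h N).
rewrite (eq_big_nat _ _ (F2 := fun n => (bounded N n * x ^+ n)%:E)); last first.
  by move=> n /andP[_ nN]; rewrite bounded_coef_total // ltnW.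
by apply: nneseries_lim_ge => n _ _; rewrite lee_fin mulr_ge0 ?exprn_ge0 // bounded_coef_ge0.
Qed.

(** The Euler operator x d/dx applied to the total generating function, computed
from the recurrence [total_coef_first] instead of by differentiation. *)
Lemma genfun_total_diff x W : 0 <= x < 1 -> genfun total x = W%:E ->
  genfun (fun n => n%:R * total n) x = (theta * (x / (1 - x)) * W)%:E.
Proof.
move=> x01 eW; have /andP[x0 x1] := x01.
have t0 n : 0 <= total n by rewrite ltW // total_coef_gt0.
have W0 : 0 <= W by rewrite -lee_fin -eW genfun_ge0.
transitivity (genfun (fun n => theta * \sum_(k < n) total (n - k.+1)) x).
  by apply: eq_eseriesr => n _; rewrite total_coef_first.
rewrite genfunZ //; last by move=> n; rewrite sumr_ge0.
rewrite (@genfun_shifts _ (fun=> total)) //.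
rewrite (eq_eseriesr (g := fun k : nat => (W * x)%:E * (x ^+ k)%:E)%E); last first.
  by move=> k _; rewrite eW -!EFinM exprS mulrC mulrA.
rewrite nneseriesZl; last by move=> k _; rewrite lee_fin exprn_ge0.
by rewrite nneseries_geometric // -!EFinM; congr (_%:E); ring.
Qed.

End CycleGF.

(** * The exponential integral *)

Section ExponentialIntegral.
Set Implicit Arguments.
Unset Strict Implicit.
Variable R : realType.
Implicit Types a b t : R.
Local Notation mu := (@lebesgue_measure R).

Lemma nonincreasing_in_measurable (D : set R) (f : R -> R) : is_interval D ->
  (forall x y, D x -> D y -> x <= y -> f y <= f x) -> measurable_fun D f.
Proof.
move=> iD f_ni; have mD : measurable D by exact: is_interval_measurable.
apply: (measurability (@RGenCInfty.G R)) => [|/= _ [_] [r] -> <-].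
  exact: RGenCInfty.measurableE.
apply: is_interval_measurable => s t /= [Ds fs] [Dt ft] u sut.
have Du := iD _ _ Ds Dt _ sut; split => //; move: fs ft.
rewrite /= !in_itv/= !andbT => _ ft; case/andP: sut => _ ut.
by rewrite (le_trans ft) // f_ni.
Qed.

Lemma integral_expRN a :
  (\int[mu]_(t in `]a, +oo[) (expR (- t))%:E = (expR (- a))%:E)%E.
Proof.
have cf : continuous (fun t : R => expR (- t)).
  by move=> t; apply: continuous_comp; [exact: opp_continuous|exact: continuous_expR].
have mf : measurable_fun setT (fun t : R => expR (- t)) by exact: continuous_measurable_fun.
have dF t : is_derive t (1:R) (fun t : R => - expR (- t)) (expR (- t)).
  by apply: is_derive_eq; rewrite mulrN1 opprK.
rewrite integral_itv_obnd_cbnd; last first.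
  by apply/measurable_EFinP; apply: measurable_funS mf.
rewrite (@ge0_continuous_FTC2y _ _ (fun t => - expR (- t)) _ 0).
- by rewrite EFinN oppeK add0e.
- by move=> t _; exact: expR_ge0.
- exact: continuous_subspaceT.
- by rewrite -[X in _ --> X]oppr0; apply: cvgN; exact: cvgr_expR.
- by move=> t _; apply: ex_derive; exact: dF.
- apply: cvg_at_right_filter; apply: cvgN; exact: cf.
- by move=> t _; rewrite derive1E; apply: derive_val.
Qed.

Lemma integrable_expRN a : mu.-integrable `]a, +oo[ (fun t => (expR (- t))%:E).
Proof.
apply/integrableP; split.
  apply/measurable_EFinP; apply: (@measurable_funS _ _ _ _ setT) => //.
  apply: continuous_measurable_fun => t.
  by apply: continuous_comp; [exact: opp_continuous|exact: continuous_expR].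
under eq_integral do rewrite gee0_abs ?lee_fin ?expR_ge0 //.
by rewrite integral_expRN ltry.
Qed.

Lemma expRN_div_nincr a b : 0 < a -> a <= b -> expR (- b) / b <= expR (- a) / a.
Proof.
move=> a0 ab; have b0 := lt_le_trans a0 ab.
by rewrite ler_pM ?expR_ge0 ?invr_ge0 ?(ltW b0) // ?ler_expR ?lerN2 // lef_pV2.
Qed.

Lemma measurable_expRN_div a : 0 <= a ->
  measurable_fun `]a, +oo[ (fun t : R => expR (- t) / t).
Proof.
move=> a0; apply: nonincreasing_in_measurable; first exact: interval_is_interval.
move=> x y /=; rewrite !in_itv /= !andbT => ax _ xy.
by apply: expRN_div_nincr => //; exact: le_lt_trans ax.
Qed.

Lemma integrable_expRN_div a : 0 < a ->
  mu.-integrable `]a, +oo[ (fun t => (expR (- t) / t)%:E).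
Proof.
move=> a0; refine (@le_integrable _ _ R mu `]a, +oo[%classic _ _ (fun t : R => (a^-1%:E * (expR (- t))%:E)%E) _ _ _).
- by [].
- by apply/measurable_EFinP; apply: measurable_expRN_div; exact: ltW.
- move=> t /=; rewrite in_itv /= andbT => at_; have t0 := lt_trans a0 at_.
  rewrite lee_fin !ger0_norm; last 2 first.
  + by rewrite mulr_ge0 ?expR_ge0 // invr_ge0 ltW.
  + by rewrite divr_ge0 ?expR_ge0 // ltW.
  by rewrite mulrC ler_wpM2r ?expR_ge0 // lef_pV2 // ltW.
- by apply: integrableZl => //; exact: integrable_expRN.
Qed.

Lemma expint1_ge0 a : 0 <= a -> 0 <= expint1 a.
Proof.
move=> a0; apply: Rintegral_ge0 => t /=; rewrite in_itv /= andbT => at_.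
by rewrite divr_ge0 ?expR_ge0 // ltW // (le_lt_trans a0).
Qed.

Lemma expint1_le a : 0 < a -> expint1 a <= expR (- a) / a.
Proof.
move=> a0.
have <- : \int[mu]_(t in `]a, +oo[) (a^-1 * expR (- t)) = expR (- a) / a.
  rewrite RintegralZl //; last exact: integrable_expRN.
  by rewrite /Rintegral integral_expRN mulrC.
apply: le_Rintegral => //; first exact: integrable_expRN_div.
  have h : mu.-integrable `]a, +oo[ (fun t : R => (a^-1%:E * (expR (- t))%:E)%E).
    by apply: integrableZl => //; exact: integrable_expRN.
  exact: h.
move=> t /=; rewrite in_itv /= andbT => at_; have t0 := lt_trans a0 at_.
by rewrite mulrC ler_wpM2r ?expR_ge0 // lef_pV2 // ltW.
Qed.

Lemma expint1_sub a b : 0 < a -> a <= b ->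
  expint1 a - expint1 b = \int[mu]_(t in `]a, b]) (expR (- t) / t).
Proof.
move=> a0 ab.
rewrite /expint1 -(@Rintegral_itvB _ _ (BRight a) (BInfty _ false) b).
- by rewrite subKr.
- exact: integrable_expRN_div.
- by rewrite bnd_simp.
- by [].
Qed.

Lemma Rintegral_itv_bounds a b (f : R -> R) c d : a <= b ->
  mu.-integrable `]a, b] (EFin \o f) ->
  (forall t, a < t <= b -> c <= f t <= d) ->
  c * (b - a) <= \int[mu]_(t in `]a, b]) f t <= d * (b - a).
Proof.
move=> ab fi cfd.
have e r : r * (b - a) = \int[mu]_(t in `]a, b]) r.
  rewrite Rintegral_cst //= lebesgue_measure_itv /= lte_fin.
  by move: ab; rewrite le_eqVlt => /predU1P[->|->]//; rewrite ltxx subrr !mulr0.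
have ic r : mu.-integrable `]a, b] (EFin \o (fun=> r)).
  apply/integrableP; split; first exact: measurable_cst.
  rewrite integral_cst //= lebesgue_measure_itv /= lte_fin; case: ifP => _.
    by rewrite -EFinB -EFinM ltry.
  by rewrite mule0.
by rewrite !e; apply/andP; split; apply: le_Rintegral => // t /=;
  rewrite in_itv /= => /cfd/andP[].
Qed.

Lemma expint1_sub_bounds a b : 0 < a -> a <= b ->
  expR (- b) / b * (b - a) <= expint1 a - expint1 b <= expR (- a) / a * (b - a).
Proof.
move=> a0 ab; rewrite expint1_sub //; apply: Rintegral_itv_bounds => //.
  apply: integrableS (integrable_expRN_div a0) => // t /=.
  by rewrite !in_itv /= andbT => /andP[].
move=> t /andP[at_ tb]; rewrite !expRN_div_nincr // ?ltW //; exact: lt_trans at_.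
Qed.

Lemma expint1_nincr a b : 0 < a -> a <= b -> expint1 b <= expint1 a.
Proof.
move=> a0 ab; have b0 := lt_le_trans a0 ab.
rewrite -subr_ge0; apply: le_trans (proj1 (andP (expint1_sub_bounds a0 ab))).
by rewrite !mulr_ge0 ?expR_ge0 ?invr_ge0 ?subr_ge0 // ltW.
Qed.

End ExponentialIntegral.

(** * Riemann sums of the limit integral *)

Section RiemannSums.
Set Implicit Arguments.
Unset Strict Implicit.
Variables (R : realType) (theta : R).
Hypothesis theta_gt0 : 0 < theta.
Local Notation mu := (@lebesgue_measure R).

(** Not a probability density: up to a factor theta, [limit_density t] dt is the
limiting weight of a marked cycle of length about t / s that is the longest. *)
Definition limit_density (t : R) : R := expR (- t - theta * expint1 t).

Definition limit_integral : R := \int[mu]_(t in `]0, +oo[) limit_density t.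

Lemma limit_densityE t : limit_density t = expR (- t) * expR (- (theta * expint1 t)).
Proof. by rewrite -expRD. Qed.

Lemma measurable_limit_density : measurable_fun `](0:R), +oo[ limit_density.
Proof.
rewrite (_ : limit_density = fun t => expR (- t) * expR (- (theta * expint1 t))); last first.
  by apply/funext => t; exact: limit_densityE.
apply: measurable_funM; apply: measurableT_comp => //.
apply: measurableT_comp => //; apply: measurable_funM => //.
apply: nonincreasing_in_measurable; first exact: interval_is_interval.
by move=> x y /=; rewrite !in_itv /= !andbT => x0 _; exact: expint1_nincr.
Qed.

Lemma limit_density_ge0 t : 0 <= limit_density t.
Proof. exact: expR_ge0. Qed.

Lemma integrable_limit_density : mu.-integrable `](0:R), +oo[ (EFin \o limit_density).
Proof.
apply: (le_integrable _ _ _ (integrable_expRN 0)) => //.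
  by apply/measurable_EFinP; exact: measurable_limit_density.
move=> t /=; rewrite in_itv /= andbT => t0.
rewrite lee_fin !ger0_norm ?expR_ge0 // ler_expR gerBl.
by rewrite mulr_ge0 ?expint1_ge0 // ltW.
Qed.

Lemma limit_integralE :
  limit_integral%:E = (\int[mu]_(t in `]0%R, +oo[) (limit_density t)%:E)%E.
Proof. by rewrite /limit_integral /Rintegral fineK // integrable_fin_num // integrable_limit_density. Qed.

Lemma limit_integral_ge0 : 0 <= limit_integral.
Proof. by apply: Rintegral_ge0 => t _; exact: limit_density_ge0. Qed.

Definition cell (s : R) (k : nat) : set R := `](k%:R * s), (k.+1%:R * s)].

Lemma limit_integral_cells s : 0 < s ->
  limit_integral%:E =
  (\sum_(k <oo) (\int[mu]_(t in cell s k) limit_density t)%:E)%E.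
Proof.
move=> s0.
have subc k : cell s k `<=` `](0:R), +oo[.
  move=> t; rewrite /cell /= !in_itv /= andbT => /andP[+ _].
  by apply: le_lt_trans; rewrite mulr_ge0 // ltW.
have cup : `](0:R), +oo[%classic = \bigcup_k cell s k.
  apply/seteqP; split=> [t|t [k _]]; last exact: subc.
  rewrite /= in_itv /= andbT => t0.
  have ts0 : 0 < t / s by rewrite divr_gt0.
  pose N := Num.truncn (t / s).
  have /andP[N1 N2] := truncn_itv (ltW ts0).
  have [e|ne] := eqVneq (N%:R) (t / s).
    (* Cells are closed on the right: a multiple of s belongs to the previous cell. *)
    have N0 : (0 < N)%N by rewrite -(ltr_nat R) e.
    exists N.-1 => //; rewrite /cell /= in_itv /= prednK // e divfK ?gt_eqF // lexx andbT.
    by rewrite -ltr_pdivlMr // -e ltr_nat prednK.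
  exists N => //; rewrite /cell /= in_itv /= -ltr_pdivlMr // -ler_pdivrMr //.
  by rewrite lt_neqAle ne N1 ltW.
rewrite limit_integralE cup ge0_integral_bigcup.
- apply: eq_eseriesr => k _; rewrite /Rintegral fineK //.
  have h : mu.-integrable (cell s k) (EFin \o limit_density).
    by apply: (@integrableS _ _ R mu _ _ _ _ _ (subc k) integrable_limit_density);
      exact: measurable_itv.
  by apply: integrable_fin_num => //; exact: measurable_itv.
- by move=> k; exact: measurable_itv.
- by apply/measurable_EFinP; rewrite -cup; exact: measurable_limit_density.
- by move=> t _; rewrite lee_fin limit_density_ge0.
- apply/trivIsetP => i j _ _; wlog ij : i j / (i < j)%N => [h|_].
    rewrite neq_ltn => /orP[ij|ji]; first by apply: h => //; rewrite neq_ltn ij.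
    by rewrite setIC; apply: h => //; rewrite neq_ltn ji.
  apply/seteqP; split=> // t []; rewrite /cell /= !in_itv /= => /andP[_ ti] /andP[jt _].
  have := lt_le_trans jt ti; rewrite ltr_pM2r // ltr_nat ltnS leqNgt.
  by rewrite ij.
Qed.

(** The density is the product of a decreasing and of an increasing function, so
each factor is estimated at its own end of the cell. The lower estimate
needs 0 < k because E_1 is infinite at 0, where [expint1] has a junk value. *)
Lemma cell_bounds s k : 0 < s ->
  \int[mu]_(t in cell s k) limit_density t <=
    s * (expR (- (k%:R * s)) * expR (- (theta * expint1 (k.+1%:R * s)))) /\
  ((0 < k)%N -> s * (expR (- (k.+1%:R * s)) * expR (- (theta * expint1 (k%:R * s)))) <=
    \int[mu]_(t in cell s k) limit_density t).
Proof.
move=> s0.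
have ab : k%:R * s <= k.+1%:R * s by rewrite ler_pM2r // ler_nat.
have es : k.+1%:R * s - k%:R * s = s by rewrite -mulrBl -natrB // subSnn mul1r.
have a0 : 0 <= k%:R * s by rewrite mulr_ge0 // ltW.
have fi : mu.-integrable `]k%:R * s, k.+1%:R * s] (EFin \o limit_density).
  apply: integrableS integrable_limit_density => // t /=.
  by rewrite !in_itv /= andbT => /andP[+ _]; exact: le_lt_trans.
split=> [|k0].
  suff /(Rintegral_itv_bounds ab fi)/andP[_] : forall t, k%:R * s < t <= k.+1%:R * s ->
    0 <= limit_density t <= expR (- (k%:R * s)) * expR (- (theta * expint1 (k.+1%:R * s))).
    by rewrite es (mulrC s).
  move=> t /andP[at_ tb]; rewrite limit_density_ge0 limit_densityE /=.
  apply: ler_pM; [exact: expR_ge0|exact: expR_ge0|by rewrite ler_expR lerN2 ltW|].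
  rewrite ler_expR lerN2 ler_pM2l //.
  by apply: expint1_nincr => //; exact: le_lt_trans at_.
have k0' : 0 < k%:R * s by rewrite mulr_gt0 // ltr0n.
suff /(Rintegral_itv_bounds ab fi)/andP[+ _] : forall t, k%:R * s < t <= k.+1%:R * s ->
  expR (- (k.+1%:R * s)) * expR (- (theta * expint1 (k%:R * s))) <= limit_density t <= 1.
  by rewrite es (mulrC s).
move=> t /andP[at_ tb]; have t0 := lt_trans k0' at_; apply/andP; split.
  rewrite limit_densityE.
  apply: ler_pM; [exact: expR_ge0|exact: expR_ge0|by rewrite ler_expR lerN2|].
  rewrite ler_expR lerN2 ler_pM2l //.
  by apply: expint1_nincr => //; exact: ltW.
rewrite -expR0 ler_expR subr_le0 (le_trans _ (mulr_ge0 (ltW theta_gt0) (expint1_ge0 (ltW t0)))) //.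
by rewrite oppr_le0 ltW.
Qed.

End RiemannSums.

(** * Comparison of the truncated and the total generating functions *)

Section TruncatedComparison.
Set Implicit Arguments.
Unset Strict Implicit.
Variables (R : realType) (theta : R).
Hypothesis theta_gt0 : 0 < theta.
Implicit Types (s : R) (m n k d : nat).
Local Notation bounded := (bounded_coef theta).
Local Notation total := (total_coef theta).
Local Notation longestc := (longest_coef theta).
Local Notation I := (limit_integral theta).

Lemma expRN_pow s k : expR (- s) ^+ k = expR (- (k%:R * s)).
Proof. by rewrite -expRM_natl mulrN. Qed.

Definition bounded_genfun s m : R :=
  expR (theta * \sum_(k < m) expR (- s) ^+ k.+1 / k.+1%:R).

Lemma bounded_genfunE s m : genfun (bounded m) (expR (- s)) = (bounded_genfun s m)%:E.
Proof. by rewrite genfun_bounded // expR_ge0. Qed.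

(** Each term of the tail of the series of -log (1 - x) is a Riemann sum term for
the integral of exp(-t) / t, evaluated at the left end of its interval here and
at the right end in the next lemma. *)
Lemma harmonic_term_ge s k : 0 < s ->
  expint1 (k.+1%:R * s) - expint1 (k.+2%:R * s) <= expR (- s) ^+ k.+1 / k.+1%:R.
Proof.
move=> s0; have k0 : 0 < k.+1%:R :> R by rewrite ltr0n.
have a0 : 0 < k.+1%:R * s by rewrite mulr_gt0.
have ab : k.+1%:R * s <= k.+2%:R * s by rewrite ler_pM2r // ler_nat.
have /andP[_ /le_trans] := expint1_sub_bounds a0 ab; apply.
rewrite expRN_pow -mulrBl -natrB // subSnn mul1r invfM -!mulrA mulVf ?gt_eqF //.
by rewrite mulr1.
Qed.

Lemma harmonic_term_le s k : 0 < s -> (0 < k)%N ->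
  expR (- s) ^+ k.+1 / k.+1%:R <= expint1 (k%:R * s) - expint1 (k.+1%:R * s).
Proof.
move=> s0 k0; have k0' : 0 < k%:R :> R by rewrite ltr0n.
have a0 : 0 < k%:R * s by rewrite mulr_gt0.
have ab : k%:R * s <= k.+1%:R * s by rewrite ler_pM2r // ler_nat.
have /andP[+ _] := expint1_sub_bounds a0 ab; apply: le_trans.
rewrite expRN_pow -mulrBl -natrB // subSnn mul1r invfM -!mulrA mulVf ?gt_eqF //.
by rewrite mulr1.
Qed.

Lemma bounded_genfunS s m :
  bounded_genfun s m.+1 = bounded_genfun s m * expR (theta * (expR (- s) ^+ m.+1 / m.+1%:R)).
Proof. by rewrite /bounded_genfun big_ord_recr /= mulrDr expRD. Qed.

Lemma bounded_genfun_growth_le s m d : 0 < s -> (0 < m)%N ->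
  bounded_genfun s (m + d) <=
  bounded_genfun s m * expR (theta * (expint1 (m%:R * s) - expint1 ((m + d)%:R * s))).
Proof.
move=> s0 m0; elim: d => [|d IH]; first by rewrite addn0 subrr mulr0 expR0 mulr1.
rewrite addnS bounded_genfunS.
apply: (le_trans (ler_wpM2r (expR_ge0 _) IH)).
rewrite -mulrA -[X in _ * X <= _]expRD ler_wpM2l ?expR_ge0 // ler_expR -mulrDr ler_pM2l //.
have md0 : (0 < m + d)%N by rewrite addn_gt0 m0.
have := harmonic_term_le s0 md0; move: (_ / _) (expint1 _) (expint1 _) (expint1 _) => p u v w; lra.
Qed.

Lemma bounded_genfun_growth_ge s m d : 0 < s ->
  bounded_genfun s m * expR (theta * (expint1 (m.+1%:R * s) - expint1 ((m + d).+1%:R * s)))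
  <= bounded_genfun s (m + d).
Proof.
move=> s0; elim: d => [|d IH]; first by rewrite addn0 subrr mulr0 expR0 mulr1.
rewrite addnS bounded_genfunS.
apply: le_trans (ler_wpM2r (expR_ge0 _) IH).
rewrite -mulrA -[X in _ <= _ * X]expRD ler_wpM2l ?expR_ge0 // ler_expR -mulrDr ler_pM2l //.
have := harmonic_term_ge (m + d) s0; move: (_ / _) (expint1 _) (expint1 _) (expint1 _) => p u v w; lra.
Qed.

Lemma expint1_cvg0 s : 0 < s -> expint1 (n.+1%:R * s) @[n --> \oo] --> (0 : R).
Proof.
move=> s0.
have h : s^-1 * n.+1%:R^-1 @[n --> \oo] --> (0 : R).
  by rewrite -[X in _ --> X](mulr0 s^-1); apply: cvgM; [exact: cvg_cst|exact: cvg_harmonic].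
apply: (squeeze_cvgr _ (cvg_cst 0) h); apply: nearW => n.
have a0 : 0 < n.+1%:R * s by rewrite mulr_gt0 // ltr0n.
rewrite expint1_ge0 ?(ltW a0) //= (le_trans (expint1_le a0)) //.
rewrite -invfM [s * _]mulrC ler_piMl ?invr_ge0 ?(ltW a0) //.
by rewrite -[leRHS]expR0 ler_expR oppr_le0 ltW.
Qed.

(** The telescoped comparison of [bounded_genfun s m] with [bounded_genfun s K],
when K tends to infinity. The upper estimate of [W] also proves that the total
generating function is finite. *)
Lemma genfun_total_bounds s : 0 < s -> exists W : R,
  [/\ genfun total (expR (- s)) = W%:E, 1 <= W,
    forall m, (0 < m)%N -> W <= bounded_genfun s m * expR (theta * expint1 (m%:R * s)) &
    forall m, bounded_genfun s m * expR (theta * expint1 (m.+1%:R * s)) <= W].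
Proof.
move=> s0; have x0 := expR_ge0 (- s).
have up m : (0 < m)%N ->
    (genfun total (expR (- s)) <= (bounded_genfun s m * expR (theta * expint1 (m%:R * s)))%:E)%E.
  move=> m0; apply: genfun_total_le => // k; rewrite bounded_genfunE lee_fin.
  have mono d : bounded_genfun s k <= bounded_genfun s (k + d).
    elim: d => [|d IH]; first by rewrite addn0.
    rewrite addnS bounded_genfunS (le_trans IH) // ler_peMr ?expR_ge0 //.
    rewrite -[leLHS]expR0 ler_expR; apply: mulr_ge0; first exact: ltW.
    by apply: divr_ge0 => //; exact: exprn_ge0.
  rewrite (le_trans (mono m)) // addnC (le_trans (bounded_genfun_growth_le _ _ _)) //.
  rewrite ler_wpM2l ?expR_ge0 // ler_expR ler_pM2l // gerBl expint1_ge0 //.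
  by rewrite mulr_ge0 // ltW.
have fin : genfun total (expR (- s)) \is a fin_num.
  rewrite ge0_fin_numE; first exact: le_lt_trans (up 1%N isT) (ltry _).
  by apply: genfun_ge0 => // n; rewrite ltW // total_coef_gt0.
exists (fine (genfun total (expR (- s)))).
have low m : bounded_genfun s m <= fine (genfun total (expR (- s))).
  by rewrite -lee_fin fineK // -bounded_genfunE genfun_bounded_le_total.
split; first by rewrite fineK.
- by apply: le_trans (low 0%N); rewrite /bounded_genfun big_ord0 mulr0 expR0.
- by move=> m m0; rewrite -lee_fin fineK // up.
- move=> m; set W := fine _ in low *.
  have h : bounded_genfun s m * expR (theta * (expint1 (m.+1%:R * s) - expint1 (n.+1%:R * s)))
      @[n --> \oo] --> bounded_genfun s m * expR (theta * expint1 (m.+1%:R * s)).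
    apply: cvgM; first exact: cvg_cst.
    apply: continuous_cvg; first exact: continuous_expR.
    apply: cvgM; first exact: cvg_cst.
    rewrite -[X in _ --> X]subr0.
    by apply: cvgB; [exact: cvg_cst|exact: expint1_cvg0].
  rewrite -(cvg_lim (@Rhausdorff R) h); apply: limr_le; first by apply/cvg_ex; eexists; exact: h.
  exists m => // n /= mn; rewrite -(subnKC mn).
  exact: le_trans (bounded_genfun_growth_ge _ _ s0) (low _).
Qed.

End TruncatedComparison.

(** * Identification of the limit *)

Section AbelianArgument.
Set Implicit Arguments.
Unset Strict Implicit.
Variables (R : realType) (theta : R).
Hypothesis theta_gt0 : 0 < theta.
Implicit Types (s W : R) (m n k d : nat).
Local Notation mu := (@lebesgue_measure R).
Local Notation bounded := (bounded_coef theta).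
Local Notation total := (total_coef theta).
Local Notation longestc := (longest_coef theta).
Local Notation I := (limit_integral theta).
Local Notation J s k := (\int[mu]_(t in cell s k) limit_density theta t).

Lemma cell_ge0 s k : 0 <= J s k.
Proof. by apply: Rintegral_ge0 => t _; exact: limit_density_ge0. Qed.

Lemma sum_bounded_genfunE s (h : nat -> nat) :
  genfun (fun n => theta * \sum_(k < n) bounded (h k) (n - k.+1)) (expR (- s)) =
  (theta%:E * \sum_(k <oo) (expR (- s) ^+ k.+1 * bounded_genfun theta s (h k))%:E)%E.
Proof.
have x0 := expR_ge0 (- s).
have b0 k n : 0 <= bounded (h k) n by exact: bounded_coef_ge0.
rewrite genfunZ //; last by move=> n; apply: sumr_ge0 => k _.
rewrite (@genfun_shifts _ (fun k => bounded (h k))) //; congr (_ * _)%E.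
by apply: eq_eseriesr => k _; rewrite bounded_genfunE // EFinM.
Qed.

(** The weight of a longest cycle of length k + 1 is compared with the integral over
the cell k + 2; the factor exp (2 s) pays for this shift. *)
Lemma genfun_longest_le s W : 0 < s ->
  (forall m, bounded_genfun theta s m * expR (theta * expint1 (m.+1%:R * s)) <= W) ->
  (genfun longestc (expR (- s)) <= (theta * W * expR (2 * s) * I / s)%:E)%E.
Proof.
move=> s0 hW.
have W0 : 0 <= W by apply: le_trans (hW 0%N); rewrite mulr_ge0 ?expR_ge0.
apply: (@le_trans _ _ (genfun (fun n => theta * \sum_(k < n) bounded k.+1 (n - k.+1)) (expR (- s)))).
  apply: le_gf; first exact: expR_ge0.
  by move=> n; rewrite longest_coef_ge0 //= longest_coef_le.
rewrite sum_bounded_genfunE.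
pose c := W * expR (2 * s) / s.
have c0 : 0 <= c by rewrite divr_ge0 ?mulr_ge0 ?expR_ge0 // ltW.
have -> : (theta * W * expR (2 * s) * I / s)%:E = (theta%:E * (c%:E * I%:E))%E.
  by rewrite -!EFinM; congr (_%:E); rewrite /c; ring.
rewrite lee_pmul2l ?lte_fin // (limit_integral_cells theta_gt0 s0).
rewrite -nneseriesZl => [|k _]; last by rewrite lee_fin cell_ge0.
rewrite [leRHS](nneseries_split 0 2) => [|k _]; last by rewrite -EFinM lee_fin mulr_ge0 // cell_ge0.
rewrite -[leLHS]add0e; apply: leeD.
  by apply: sume_ge0 => k _; rewrite -EFinM lee_fin mulr_ge0 // cell_ge0.
rewrite add0n -nneseries_addn => [|k]; last by rewrite -EFinM lee_fin mulr_ge0 // cell_ge0.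
apply: lee_nneseries => [k _ _|k _].
  by rewrite lee_fin mulr_ge0 ?expR_ge0 // exprn_ge0 // expR_ge0.
rewrite -EFinM lee_fin addn2.
have := (cell_bounds theta_gt0 k.+2 s0).2 isT => /(ler_wpM2l c0); apply: le_trans.
have -> : c * (s * (expR (- (k.+3%:R * s)) * expR (- (theta * expint1 (k.+2%:R * s))))) =
    expR (- s) ^+ k.+1 * (W * expR (- (theta * expint1 (k.+2%:R * s)))).
  rewrite expRN_pow (_ : - (k.+1%:R * s) = 2 * s + - (k.+3%:R * s)); last first.
    by rewrite -[k.+3%:R]natr1 -[k.+2%:R]natr1; ring.
  rewrite expRD /c; move: (expR _) (expR _) (expR _) => p q r.
  by field; rewrite gt_eqF.
rewrite ler_wpM2l ?exprn_ge0 ?expR_ge0 // expRN ler_pdivlMr ?expR_gt0 //.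
Qed.

(** As in [genfun_longest_le], in the other direction: length k + 2 is compared with
the cell k, and the cycles of length 1 are discarded. *)
Lemma genfun_longest_ge s W : 0 < s -> 0 <= W ->
  (forall m, (0 < m)%N -> W <= bounded_genfun theta s m * expR (theta * expint1 (m%:R * s))) ->
  ((theta * W * expR (- (2 * s)) * I / s)%:E <= genfun longestc (expR (- s)))%E.
Proof.
move=> s0 W0 hW.
apply: (@le_trans _ _ (genfun (fun n => theta * \sum_(k < n) bounded k (n - k.+1)) (expR (- s)))); last first.
  apply: le_gf; first exact: expR_ge0.
  move=> n; rewrite longest_coef_ge // andbT mulr_ge0 ?(ltW theta_gt0) //.
  by apply: sumr_ge0 => k _; exact: bounded_coef_ge0.
rewrite (sum_bounded_genfunE _ id).
pose c := W * expR (- (2 * s)) / s.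
have c0 : 0 <= c by rewrite divr_ge0 ?mulr_ge0 ?expR_ge0 // ltW.
have -> : (theta * W * expR (- (2 * s)) * I / s)%:E = (theta%:E * (c%:E * I%:E))%E.
  by rewrite -!EFinM; congr (_%:E); rewrite /c; ring.
rewrite lee_pmul2l ?lte_fin // (limit_integral_cells theta_gt0 s0).
rewrite -nneseriesZl => [|k _]; last by rewrite lee_fin cell_ge0.
have t0 k : (0 <= (expR (- s) ^+ k.+1 * bounded_genfun theta s k)%:E)%E.
  by rewrite lee_fin mulr_ge0 ?expR_ge0 // exprn_ge0 // expR_ge0.
rewrite [leRHS](nneseries_split 0 1) => [|k _]; last exact: t0.
rewrite -[leLHS]add0e; apply: leeD; first by apply: sume_ge0 => k _; exact: t0.
rewrite add0n -nneseries_addn => [|k]; last exact: t0.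
apply: lee_nneseries => [k _ _|k _]; first by rewrite -EFinM lee_fin mulr_ge0 // cell_ge0.
rewrite -EFinM lee_fin addn1.
have := (cell_bounds theta_gt0 k s0).1 => /(ler_wpM2l c0)/le_trans; apply.
have -> : c * (s * (expR (- (k%:R * s)) * expR (- (theta * expint1 (k.+1%:R * s))))) =
    expR (- s) ^+ k.+2 * (W * expR (- (theta * expint1 (k.+1%:R * s)))).
  rewrite expRN_pow (_ : - (k.+2%:R * s) = - (2 * s) + - (k%:R * s)); last first.
    by rewrite -[k.+2%:R]natr1 -[k.+1%:R]natr1; ring.
  rewrite expRD /c; move: (expR _) (expR _) (expR _) => p q r.
  by field; rewrite gt_eqF.
rewrite ler_wpM2l ?exprn_ge0 ?expR_ge0 // expRN ler_pdivrMr ?expR_gt0 //.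
by rewrite hW.
Qed.

Lemma longest_coef_ratio n : longestc n = mean_ratio theta n * (n%:R * total n).
Proof.
case: n => [|n]; first by rewrite mul0r mulr0 /longest_coef cycle_coef0 /longest big_nil.
by rewrite /mean_ratio divfK // mulf_neq0 ?pnatr_eq0 // gt_eqF // total_coef_gt0.
Qed.

Lemma expR_odds s : 0 < s -> expR (- s) / (1 - expR (- s)) = (expR s - 1)^-1.
Proof.
move=> s0; rewrite expRN; have e1 : 1 < expR s by rewrite -[ltLHS]expR0 ltr_expR.
have e0 := expR_gt0 s; move: (expR s) e0 e1 => e e0 e1.
by field; rewrite !gt_eqF ?subr_gt0 //.
Qed.

Lemma genfun_mean s W : 0 < s -> genfun total (expR (- s)) = W%:E ->
  genfun (fun n => n%:R * total n) (expR (- s)) = (theta * W / (expR s - 1))%:E.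
Proof.
move=> s0 eW; rewrite (genfun_total_diff theta_gt0 _ eW); last first.
  by rewrite expR_ge0 /= -[ltRHS]expR0 ltr_expR oppr_lt0.
by rewrite expR_odds // mulrAC.
Qed.

(** Replacing every ratio by its lower bound lam in the generating function of the
longest cycle, then dividing by theta W / (exp s - 1). *)
Lemma lower_mean_bound (lam : R) : 0 <= lam -> (forall n, lam <= mean_ratio theta n.+1) ->
  forall s, 0 < s -> lam <= expR (3 * s) * I.
Proof.
move=> lam0 hlam s s0; have [W [eW W1 _ hW]] := genfun_total_bounds theta_gt0 s0.
have W0 : 0 < W by exact: lt_le_trans W1.
have e1 : 0 < expR s - 1 by rewrite subr_gt0 -[ltLHS]expR0 ltr_expR.
have I0 : 0 <= I := limit_integral_ge0 theta.
have d0 n : 0 <= n%:R * total n by rewrite mulr_ge0 // ltW // total_coef_gt0.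
have : (genfun (fun n => (lam * (n%:R * total n))%R) (expR (- s)) <= genfun longestc (expR (- s)))%E.
  apply: le_gf; first exact: expR_ge0.
  move=> [|n]; first by rewrite mul0r mulr0 lexx /= longest_coef_ge0.
  by rewrite mulr_ge0 //= longest_coef_ratio ler_wpM2r.
rewrite genfunZ ?expR_ge0 // (genfun_mean s0 eW) => /le_trans/(_ (genfun_longest_le s0 hW)).
rewrite -EFinM lee_fin => h.
have {h} : lam <= expR (2 * s) * I * ((expR s - 1) / s).
  have k0 : 0 < theta * W / (expR s - 1) by rewrite divr_gt0 // mulr_gt0.
  rewrite -(ler_pM2r k0) (le_trans h) //.
  by rewrite le_eqVlt; apply/orP; left; apply/eqP; field; rewrite !gt_eqF.
move/le_trans; apply.
(* This is 1 - exp(-s) <= s. *)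
have es : (expR s - 1) / s <= expR s.
  rewrite ler_pdivrMr // -subr_ge0.
  have := expR_ge1Dx (- s); have := expR_gt0 s; rewrite expRN => E.
  rewrite -(ler_pM2l E) divff ?gt_eqF //; lra.
rewrite (_ : 3 * s = 2 * s + s); last by ring.
by rewrite expRD mulrAC ler_wpM2r // ler_wpM2l ?expR_ge0.
Qed.

(** The finitely many ratios that exceed c contribute at most a constant, which is
negligible against theta W / (exp s - 1) when s tends to 0. *)
Lemma upper_mean_bound (c : R) N : 0 <= c -> (forall n, (N <= n)%N -> mean_ratio theta n <= c) ->
  exists C : R, forall s, 0 < s -> expR (- (2 * s)) * I - C * (expR s - 1) <= c.
Proof.
move=> c0 hc; pose C := \sum_(0 <= n < N) longestc n.
have C0 : 0 <= C by apply: sumr_ge0 => n _; exact: longest_coef_ge0.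
exists (C / theta) => s s0; have [W [eW W1 hW _]] := genfun_total_bounds theta_gt0 s0.
have W0 : 0 < W by exact: lt_le_trans W1.
have e1 : 0 < expR s - 1 by rewrite subr_gt0 -[ltLHS]expR0 ltr_expR.
have I0 : 0 <= I := limit_integral_ge0 theta.
have d0 n : 0 <= n%:R * total n by rewrite mulr_ge0 // ltW // total_coef_gt0.
have x0 := expR_ge0 (- s).
have l0 n := longest_coef_ge0 theta_gt0 n.
have lt0 n : (0 <= (longestc n * expR (- s) ^+ n)%:E)%E.
  by rewrite lee_fin mulr_ge0 // exprn_ge0.
have : (genfun longestc (expR (- s)) <= C%:E + genfun (fun n => (c * (n%:R * total n))%R) (expR (- s)))%E.
  rewrite /genfun (nneseries_split 0 N) // add0n; apply: leeD.
    rewrite sumEFin lee_fin; apply: ler_sum => n _.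
    by rewrite ler_piMr // exprn_ile1 // -[leRHS]expR0 ler_expR oppr_le0 ltW.
  rewrite [leRHS](nneseries_split 0 N); last first.
    by move=> n _; rewrite lee_fin mulr_ge0 ?exprn_ge0 // mulr_ge0.
  rewrite add0n -[leLHS]add0e; apply: leeD.
    by apply: sume_ge0 => n _; rewrite lee_fin mulr_ge0 ?exprn_ge0 // mulr_ge0.
  rewrite eseries_cond [leRHS]eseries_cond; apply: lee_nneseries => n //= Nn.
  by rewrite lee_fin ler_wpM2r ?exprn_ge0 // longest_coef_ratio ler_wpM2r // hc.
rewrite genfunZ // (genfun_mean s0 eW) => /(le_trans (genfun_longest_ge s0 (ltW W0) hW)).
rewrite -EFinM -EFinD lee_fin => h.
have k0 : 0 < theta * W by rewrite mulr_gt0.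
have {h} h : expR (- (2 * s)) * I * ((expR s - 1) / s) <= C / theta / W * (expR s - 1) + c.
  have k1 : 0 < theta * W / (expR s - 1) by rewrite divr_gt0.
  rewrite -(ler_pM2r k1); move: h; set X := (X in X <= _ -> _); set Y := (X in _ <= X -> _).
  rewrite (_ : X = expR (- (2 * s)) * I * ((expR s - 1) / s) * (theta * W / (expR s - 1))).
    rewrite (_ : Y = (C / theta / W * (expR s - 1) + c) * (theta * W / (expR s - 1))) //.
    by rewrite /Y; field; rewrite !gt_eqF.
  by rewrite /X; field; rewrite !gt_eqF.
rewrite lerBlDr addrC.
have es : 1 <= (expR s - 1) / s by rewrite ler_pdivlMr // mul1r lerBrDl expR_ge1Dx.
apply: (@le_trans _ _ (expR (- (2 * s)) * I * ((expR s - 1) / s))).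
  by rewrite ler_peMr // mulr_ge0 ?expR_ge0.
apply: (le_trans h); rewrite lerD2r ler_wpM2r ?(ltW e1) //.
by rewrite ler_pdivrMr // ler_peMr // divr_ge0 // ltW.
Qed.

Lemma le_at_right0 (f : R -> R) c : {for 0, continuous f} ->
  (forall s, 0 < s -> f s <= c) -> f 0 <= c.
Proof.
move=> cf fc.
have h : f s @[s --> 0^'+] --> f 0 by exact: cvg_at_right_filter.
rewrite -(cvg_lim (@Rhausdorff R) h); apply: limr_le; first by apply/cvg_ex; eexists; exact: h.
by near=> s; apply: fc; near: s; exact: nbhs_right_gt.
Unshelve. all: by end_near. Qed.

Lemma mean_ratio_cvg : mean_ratio theta n @[n --> \oo] --> I.
Proof.
pose u n := mean_ratio theta n.+1.
have ni : nonincreasing_seq u by apply/nonincreasing_seqP => n; exact: mean_ratioS.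
have lb : has_lbound (range u) by exists 0 => _ [n _ <-]; exact: mean_ratio_ge0.
have uc : cvgn u by exact: nonincreasing_is_cvgn.
set lam := limn u.
have lamu n : lam <= u n by exact: nonincreasing_cvgn_ge.
have lam0 : 0 <= lam by apply: limr_ge => //; apply: nearW => n; exact: mean_ratio_ge0.
suff <- : lam = I by rewrite -cvg_shiftS; exact: uc.
have cexp (a : R) : {for 0, continuous (fun s : R => expR (a * s))}.
  move=> x; apply: continuous_comp; last exact: continuous_expR.
  by apply: cvgM; [exact: cvg_cst|exact: cvg_id].
apply/eqP; rewrite eq_le; apply/andP; split.
  have h : lam - expR (3 * 0) * I <= 0.
    apply: (@le_at_right0 (fun s => lam - expR (3 * s) * I)) => [|s s0].
      by apply: cvgB; [exact: cvg_cst|apply: cvgM; [exact: cexp|exact: cvg_cst]].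
    by rewrite subr_le0; apply: (lower_mean_bound lam0 lamu).
  by move: h; rewrite mulr0 expR0 mul1r subr_le0.
apply/ler_addgt0Pr => e e0.
have [N _ hN] : \forall n \near \oo, u n <= lam + e.
  by apply: (cvgr_le lam) => //; rewrite ltrDl.
have [|C hC] := @upper_mean_bound (lam + e) N.+1 (addr_ge0 lam0 (ltW e0)).
  by case=> // n nN; exact: hN.
have h : expR (- 2 * 0) * I - C * (expR (1 * 0) - 1) <= lam + e.
  apply: (@le_at_right0 (fun s => expR (- 2 * s) * I - C * (expR (1 * s) - 1))) => [|s s0].
    apply: cvgB; first by apply: cvgM; [exact: cexp|exact: cvg_cst].
    apply: cvgM; first exact: cvg_cst.
    by apply: cvgB; [exact: cexp|exact: cvg_cst].
  by rewrite mulNr mul1r; exact: hC.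
by move: h; rewrite !mulr0 expR0 subrr mulr0 subr0 mul1r.
Qed.

End AbelianArgument.

Theorem theorem4p1 (R : realType) (theta : R) (htheta : 0 < theta) :
  (fun n : nat =>
     ewens_expectation theta (fun s : 'S_n => (longest_cycle s)%:R) / n%:R)
    @ \oo -->
  \int[lebesgue_measure]_(t in `]0%R, +oo[) expR (- t - theta * expint1 t).
Proof.
rewrite (_ : (fun n => _) = mean_ratio theta).
  exact: mean_ratio_cvg.
by apply/funext => n; rewrite ewens_longest // /mean_ratio -mulrA -invfM [n%:R * _]mulrC.
Qed.
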